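(* Let $D\subseteq\mathbb{B}^n$ be a Lebesgue-measurable set with $0<\Lambda(D)<+\infty$. If $c=c(D)$ is the conformal barycenter of $D$, then $h(c)$ is the conformal barycenter of $h(D)$ for any Möbius transformation $h$ of the unit ball $\mathbb{B}^n$ onto itself.
   Context: $\mathbb{B}^n=\{x\in\mathbb{R}^n:|x|<1\}$ is the open unit ball, with Euclidean norm $|\cdot|$. The hyperbolic measure on $\mathbb{B}^n$ is $d\Lambda(x)=\frac{d\lambda(x)}{(1-|x|^2)^n}$, where $\lambda$ is Lebesgue measure on $\mathbb{R}^n$. For $a\in\mathbb{B}^n$, $$h_a(x)=\frac{a|x-a|^2+(1-|a|^2)(a-x)}{|x-a|^2+(1-|a|^2)(1-|x|^2)},$$ and Möbius transformations of $\mathbb{B}^n$ onto itself are the maps $T\circ h_a$ with $T$ an orthogonal transformation of $\mathbb{R}^n$ and $a\in\mathbb{B}^n$. For a Lebesgue-measurable set $D\subseteq\mathbb{B}^n$ with $0<\Lambda(D)<+\infty$, the conformal barycenter of $D$ is the unique point $c\in\mathbb{B}^n$ such that $\int_D h_c(x)\,d\Lambda(x)=0$. *)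

(* Defs.v *)
From HB Require Import structures.
From mathcomp Require Import all_boot all_order all_algebra.
From mathcomp Require Import all_classical all_reals all_analysis.

Set Implicit Arguments.
Unset Strict Implicit.
Unset Printing Implicit Defensive.

Import Order.TTheory GRing.Theory Num.Theory.
Import numFieldNormedType.Exports.

Local Open Scope classical_set_scope.
Local Open Scope ring_scope.

(* Lebesgue measure on R^n = 'rV[R]_n is obtained by the Caratheodory
   construction: the outer measure is the infimum of the total volumes of the
   countable covers by half-open boxes, and the Lebesgue-measurable sets are
   the Caratheodory-measurable ones. *)
Section LebesgueMeasure.
Context (R : realType) (n : nat).

(* Some (a, b) stands for \prod_j ]a_j, b_j] and None for the empty set; the
   latter is needed only when n = 0, where every product is the whole space. *)
Definition box_set (B : option ('rV[R]_n * 'rV[R]_n)) : set 'rV[R]_n :=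
  if B is Some (a, b) then [set x | forall j, a 0 j < x 0 j <= b 0 j]
  else set0.

(* The factor is 0 when b_j <= a_j, in which case the box is empty. *)
Definition box_volume (B : option ('rV[R]_n * 'rV[R]_n)) : R :=
  if B is Some (a, b) then \prod_(j < n) Num.max 0 (b 0 j - a 0 j) else 0.

Definition box_cover (A : set 'rV[R]_n) :
    set (nat -> option ('rV[R]_n * 'rV[R]_n)) :=
  [set F | A `<=` \bigcup_k box_set (F k)].

Definition lebesgue_outer (A : set 'rV[R]_n) : \bar R :=
  ereal_inf [set (\sum_(k <oo) (box_volume (F k))%:E)%E | F in box_cover A].

Lemma box_volume_ge0 B : 0 <= box_volume B.
Proof.
case: B => [[a b]|] /=; last exact: lexx.
by apply: prodr_ge0 => j _; rewrite le_max lexx.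
Qed.

Let vol B : \bar R := (box_volume B)%:E.

Let vol_ge0 B : (0 <= vol B)%E.
Proof. by rewrite lee_fin box_volume_ge0. Qed.

Lemma lebesgue_outer_ge0 A : (0 <= lebesgue_outer A)%E.
Proof.
apply: le_ereal_inf_tmp => _ [F AF <-]; apply: nneseries_ge0 => k _ _.
exact: vol_ge0.
Qed.

Lemma lebesgue_outer0 : lebesgue_outer set0 = 0%E.
Proof.
apply/eqP; rewrite eq_le lebesgue_outer_ge0 andbT.
by apply: ereal_inf_lbound; exists (fun=> None); [|exact: eseries0].
Qed.

Lemma le_lebesgue_outer :
  {homo lebesgue_outer : A B / A `<=` B >-> (A <= B)%E}.
Proof.
move=> A B AB; apply/ereal_inf_le_tmp => _ [F BF <-].
by exists F => //; exact: subset_trans BF.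
Qed.

Lemma lebesgue_outer_sigma_subadditive : sigma_subadditive lebesgue_outer.
Proof.
move=> A; have [[i ioo]|] := pselect (exists i, lebesgue_outer (A i) = +oo%E).
  rewrite (eseries_pinfty _ _ ioo) ?leey// => k _.
  by rewrite -ltNye (lt_le_trans _ (lebesgue_outer_ge0 _)).
rewrite -forallNE => Aoo.
suff add2e (e : {posnum R}) : (lebesgue_outer (\bigcup_k A k) <=
    \sum_(i <oo) lebesgue_outer (A i) + e%:num%:E)%E.
  by apply/lee_addgt0Pr => _/posnumP[].
rewrite (le_trans _ (epsilon_trick _ _ _))//; last first.
  by move=> k; exact: lebesgue_outer_ge0.
pose P k F := box_cover (A k) F /\ (\sum_(i <oo) vol (F i) <=
  lebesgue_outer (A k) + (e%:num / (2 ^ k.+1)%:R)%:E)%E.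
have [G PG] : {G & forall k, P k (G k)}.
  apply: (@choice _ _ P) => k; rewrite /P /lebesgue_outer.
  set S := (X in ereal_inf X); move infS : (ereal_inf S) => iS.
  case: iS infS => [r Sr|Soo|Soo].
  - have en1 : (0 < e%:num / (2 ^ k.+1)%:R)%R by [].
    have /(lb_ereal_inf_adherent en1) : ereal_inf S \is a fin_num by rewrite Sr.
    move=> [x [F AF volF] xS].
    by exists F; split => //; rewrite /vol volF -Sr; exact/ltW.
  - by have := Aoo k; rewrite /lebesgue_outer Soo.
  - by have := lebesgue_outer_ge0 (A k); rewrite /lebesgue_outer -/S Soo.
have volG_ge0 x : (0 <= (vol \o uncurry G) x)%E by exact: vol_ge0.
apply: (@le_trans _ _ (\esum_(i in setT) (vol \o uncurry G) i)%E).
  apply: ereal_inf_lbound => /=.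
  have /card_esym/ppcard_eqP[f] := card_nat2.
  exists (uncurry G \o f).
    move=> t [i _ /((PG i).1 _)[j _ Gijt]].
    by exists (f^-1%FUN (i, j)) => //=; rewrite invK ?inE.
  rewrite -(esum_pred_image (vol \o uncurry G) _ xpredT) ?[fun=> _]set_true//.
  by rewrite image_eq.
rewrite (_ : esum _ _ = \sum_(i <oo) \sum_(j <oo) vol (G i j))%E; last first.
  pose J : nat -> set (nat * nat) := fun i => [set (i, j) | j in setT].
  rewrite (_ : setT = \bigcup_k J k); last first.
    by rewrite predeqE => -[a b]; split => // _; exists a => //; exists b.
  rewrite esum_bigcupT /=; last 2 first.
    - apply/trivIsetP => i j _ _ ij.
      rewrite predeqE => -[k m] /=; split => //= -[] [_] _ [<-{k} _].
      by move=> [m' _] [] /esym/eqP; rewrite (negbTE ij).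
    - by move=> /= x; exact: volG_ge0.
  rewrite -(image_id [set: nat]) -fun_true esum_pred_image//; last first.
    by move=> k _; exact: esum_ge0.
  apply: eq_eseriesr => /= j _.
  rewrite -(esum_pred_image (vol \o uncurry G) (pair j) predT)//=; last first.
    by move=> ? ? _ _; exact: (@can_inj _ _ _ snd).
  by congr esum; rewrite predeqE => -[a b]; split; move=> [i _ <-]; exists i.
apply: lee_nneseries => [k _ _|k _]; last exact: (PG k).2.
by apply: nneseries_ge0 => m _ _; exact: vol_ge0.
Qed.

HB.instance Definition _ := isOuterMeasure.Build R 'rV[R]_n lebesgue_outer
  lebesgue_outer0 lebesgue_outer_ge0 le_lebesgue_outer
  lebesgue_outer_sigma_subadditive.

Definition lebesgueRn := caratheodory_type lebesgue_outer.

HB.instance Definition _ := Measurable.on lebesgueRn.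

Definition lebesgue_measureRn : set lebesgueRn -> \bar R := lebesgue_outer.

HB.instance Definition _ := isMeasure.Build _ lebesgueRn R lebesgue_measureRn
  (@caratheodory_measure0 _ _ lebesgue_outer)
  (@caratheodory_measure_ge0 _ _ lebesgue_outer)
  (@caratheodory_measure_sigma_additive _ _ lebesgue_outer).

Definition lebesgue_measurable (D : set 'rV[R]_n) : Prop :=
  measurable (D : set lebesgueRn).

End LebesgueMeasure.
Arguments lebesgue_measureRn {R n}.

Section ConformalBarycenter.
Context (R : realType) (n : nat).
Implicit Types (a c x : 'rV[R]_n) (D : set 'rV[R]_n).

(* The norm that the library puts on 'rV[R]_n is the sup norm. *)
Definition enorm x : R := Num.sqrt (\sum_(j < n) x 0 j ^+ 2).

Definition unit_ball : set 'rV[R]_n := [set x | enorm x < 1].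

Definition hyp_density x : R := (1 - enorm x ^+ 2) ^- n.

Definition hyp_measure D : \bar R :=
  (\int[lebesgue_measureRn]_(x in (D : set (lebesgueRn R n)))
    (hyp_density x)%:E)%E.

(* \int_D f dLambda, where dLambda = hyp_density dlambda. *)
Definition hyp_integral D (f : 'rV[R]_n -> R) : \bar R :=
  (\int[lebesgue_measureRn]_(x in (D : set (lebesgueRn R n)))
    (f x * hyp_density x)%:E)%E.

Definition h_map a x : 'rV[R]_n :=
  (enorm (x - a) ^+ 2 + (1 - enorm a ^+ 2) * (1 - enorm x ^+ 2))^-1 *:
  (enorm (x - a) ^+ 2 *: a + (1 - enorm a ^+ 2) *: (a - x)).

(* Vectors are rows, so the linear map of matrix T is x |-> x *m T; a
   transformation of the ball is constrained only on the ball. *)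
Definition is_mobius (h : 'rV[R]_n -> 'rV[R]_n) : Prop :=
  exists (T : 'M[R]_n) (a : 'rV[R]_n),
    [/\ T *m T^T = 1%:M, unit_ball a &
        forall x, unit_ball x -> h x = h_map a x *m T].

(* Only these sets have a conformal barycenter; is_conformal_barycenter D c
   therefore entails that D is one of them. *)
Definition barycenter_domain D : Prop :=
  [/\ D `<=` unit_ball, lebesgue_measurable D &
      (0 < hyp_measure D < +oo)%E].

Definition is_conformal_barycenter D c : Prop :=
  barycenter_domain D /\
  unique (fun y : 'rV[R]_n => unit_ball y /\
            forall i : 'I_n, hyp_integral D (fun x => h_map y x 0 i) = 0%E) c.

End ConformalBarycenter.
Arguments unit_ball {R n}.

(* Main.v *)
(* The quantity |x-y|^2 / ((1-|x|^2)(1-|y|^2)) is invariant under Moebius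
   transformations, and a map of the ball that preserves it and fixes 0 is
   orthogonal. Applied to h_(g y) o g o h_y this gives h_(g y) o g = T o h_y
   with T orthogonal, so that

     \int_(g D) h_(g y) dLambda = \int_D h_(g y) o g dLambda
                               = T (\int_D h_y dLambda)

   as soon as Lambda is g-invariant; hence y solves the barycenter equation of
   D iff g y solves that of g D, and uniqueness is transported as well.

   For the invariance of Lambda, the same factorisation shows that near x the
   map g is, up to a quadratic error, an orthogonal map followed by a homothety
   of ratio s(x) = (1-|g x|^2) / (1-|x|^2). As Lebesgue measure is invariant
   under orthogonal maps, covering by small dyadic cubes yields
   lambda(g A) <= M lambda(A) whenever s^n < M on A, and slicing along the
   level sets of s^n gives \int_(g A) f dlambda <= \int_A (f o g) s^n dlambda
   for f >= 0. Since s^n is the ratio of the hyperbolic densities at x and g x,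
   this is an inequality for Lambda, and the inverse of g gives the converse. *)
Require Import Defs.
From mathcomp Require Import all_boot all_order all_algebra.
From mathcomp Require Import all_classical all_reals all_analysis.
From mathcomp Require Import measurable_realfun ring lra.

Set Implicit Arguments.
Unset Strict Implicit.
Unset Printing Implicit Defensive.

Import Order.TTheory GRing.Theory Num.Theory.
Import numFieldNormedType.Exports.

Local Open Scope classical_set_scope.
Local Open Scope ring_scope.

(** * Euclidean geometry and Moebius transformations *)

Section Euclidean.
Context (R : realType) (n : nat).
Implicit Types (u v w x y a : 'rV[R]_n) (T : 'M[R]_n).

Definition dot u v : R := \sum_j u 0 j * v 0 j.

Lemma dotC u v : dot u v = dot v u.
Proof. by apply: eq_bigr => j _; rewrite mulrC. Qed.

Lemma dotDl u v w : dot (u + v) w = dot u w + dot v w.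
Proof. by rewrite -big_split/=; apply: eq_bigr => j _; rewrite mxE mulrDl. Qed.

Lemma dotZl (k : R) u v : dot (k *: u) v = k * dot u v.
Proof. by rewrite mulr_sumr; apply: eq_bigr => j _; rewrite mxE mulrA. Qed.

Lemma dotNl u v : dot (- u) v = - dot u v.
Proof. by rewrite -scaleN1r dotZl mulN1r. Qed.

Lemma dot0l u : dot 0 u = 0.
Proof. by rewrite -(scale0r 0) dotZl mul0r. Qed.

Lemma dotDr u v w : dot u (v + w) = dot u v + dot u w.
Proof. by rewrite dotC dotDl !(dotC u). Qed.

Lemma dotZr (k : R) u v : dot u (k *: v) = k * dot u v.
Proof. by rewrite dotC dotZl dotC. Qed.

Lemma dotNr u v : dot u (- v) = - dot u v.
Proof. by rewrite dotC dotNl dotC. Qed.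

Lemma dot0r u : dot u 0 = 0.
Proof. by rewrite dotC dot0l. Qed.

Definition dotE := (dotDl, dotDr, dotNl, dotNr, dotZl, dotZr, dot0l, dot0r).

Lemma dot_ge0 u : 0 <= dot u u.
Proof. by apply: sumr_ge0 => j _; rewrite -expr2 sqr_ge0. Qed.

Lemma dot_eq0 u : dot u u = 0 -> u = 0.
Proof.
move=> /eqP; rewrite psumr_eq0 => [|j _]; last by rewrite -expr2 sqr_ge0.
move=> /allP u0; apply/rowP => j; rewrite mxE; apply/eqP.
by have := u0 j; rewrite mem_index_enum -expr2 sqrf_eq0 => /(_ isT).
Qed.

Lemma dot_sqr_le u v : dot u v ^+ 2 <= dot u u * dot v v.
Proof.
have [v0|v0] := eqVneq (dot v v) 0.
  by rewrite v0 mulr0 (dot_eq0 v0) dot0r expr0n.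
have vv : 0 < dot v v by rewrite lt_neqAle eq_sym v0 dot_ge0.
(* The vector is |v|^2 times the component of u orthogonal to v. *)
have := dot_ge0 (dot v v *: u - dot u v *: v).
rewrite !dotE (dotC v u) => H.
have : 0 <= dot v v * (dot u u * dot v v - dot u v ^+ 2) by nra.
by rewrite pmulr_rge0// subr_ge0.
Qed.

Lemma dot_mulmx_orthogonal T u v : T *m T^T = 1%:M ->
  dot (u *m T) (v *m T) = dot u v.
Proof.
have dotM a b : dot a b = (a *m b^T) 0 0.
  by rewrite mxE; apply: eq_bigr => j _; rewrite mxE.
by move=> TT; rewrite !dotM trmx_mul mulmxA -(mulmxA u) TT mulmx1.
Qed.

Lemma enorm_ge0 u : 0 <= enorm u.
Proof. exact: sqrtr_ge0. Qed.

Lemma sqr_enorm u : enorm u ^+ 2 = dot u u.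
Proof.
rewrite /enorm (eq_bigr (fun j => u 0 j * u 0 j)); last by move=> j _; rewrite expr2.
by rewrite sqr_sqrtr// dot_ge0.
Qed.

Lemma enorm_sqrt u : enorm u = Num.sqrt (dot u u).
Proof. by rewrite -sqr_enorm sqrtr_sqr ger0_norm ?enorm_ge0. Qed.

Lemma enorm_le u (r : R) : 0 <= r -> (enorm u <= r) = (dot u u <= r ^+ 2).
Proof. by move=> r0; rewrite -sqr_enorm ler_pXn2r// nnegrE enorm_ge0. Qed.

Lemma unit_ballE u : unit_ball u = (dot u u < 1).
Proof.
by rewrite /unit_ball/= -sqr_enorm expr_lt1// enorm_ge0.
Qed.

Lemma unit_ball0 : unit_ball (0 : 'rV[R]_n).
Proof. by rewrite unit_ballE dot0l ltr01. Qed.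

Lemma dot_le_enorm u v : `|dot u v| <= enorm u * enorm v.
Proof.
rewrite -(ler_pXn2r (n := 2))// ?nnegrE ?mulr_ge0 ?enorm_ge0//.
by rewrite exprMn !sqr_enorm real_normK ?num_real// dot_sqr_le.
Qed.

Lemma enormD_le u v : enorm (u + v) <= enorm u + enorm v.
Proof.
rewrite enorm_le ?addr_ge0 ?enorm_ge0//.
have := dot_le_enorm u v; rewrite ler_norml => /andP[_].
have := sqr_enorm u; have := sqr_enorm v; rewrite !dotE (dotC v u); nra.
Qed.

Lemma enormZ (k : R) u : enorm (k *: u) = `|k| * enorm u.
Proof.
by rewrite !enorm_sqrt dotZl dotZr mulrA -expr2 sqrtrM ?sqr_ge0// sqrtr_sqr.
Qed.

Lemma enormN u : enorm (- u) = enorm u.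
Proof. by rewrite -scaleN1r enormZ normrN1 mul1r. Qed.

Lemma enorm_orthogonal T u : T *m T^T = 1%:M -> enorm (u *m T) = enorm u.
Proof. by move=> TT; rewrite !enorm_sqrt dot_mulmx_orthogonal. Qed.

Lemma orthogonal_trmx T : T *m T^T = 1%:M -> T^T *m T^T^T = 1%:M.
Proof. by move=> /mulmx1C; rewrite trmxK. Qed.

Lemma coord_le_enorm u j : `|u 0 j| <= enorm u.
Proof.
rewrite -(ler_pXn2r (n := 2))// ?nnegrE ?enorm_ge0// sqr_enorm.
rewrite real_normK ?num_real// /dot (bigD1 j)//= expr2 lerDl.
by apply: sumr_ge0 => i _; rewrite -expr2 sqr_ge0.
Qed.

(** The crude factor n, in place of its square root, comes from n <= n^2. *)
Lemma enorm_le_coord u (r : R) : 0 <= r -> (forall j, `|u 0 j| <= r) ->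
  enorm u <= n%:R * r.
Proof.
move=> r0 ur; have n0 : 0 <= n%:R * r by rewrite mulr_ge0.
rewrite enorm_le//; apply: (@le_trans _ _ (\sum_(j < n) r ^+ 2)).
  apply: ler_sum => j _; rewrite -expr2 -[leLHS]real_normK ?num_real//.
  by rewrite ler_pXn2r ?nnegrE.
rewrite sumr_const card_ord exprMn -[leLHS]mulr_natl ler_wpM2r ?sqr_ge0//.
by rewrite -natrX ler_nat; case: (n) => // m; rewrite -[leqLHS]expn1 leq_pexp2l.
Qed.

End Euclidean.

(** * Moebius maps as isometries of the hyperbolic distance *)

Section Mobius.
Context (R : realType) (n : nat).
Implicit Types (u v w x y z a : 'rV[R]_n) (T : 'M[R]_n).
Implicit Types (A : set 'rV[R]_n) (g : 'rV[R]_n -> 'rV[R]_n).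

(** The denominator of [h_map] in expanded form; for a nonzero a it is |a|^2 times the squared
    distance from x to the inverse point a / |a|^2. *)
Definition h_den a x : R := 1 - 2 * dot a x + dot a a * dot x x.

(** With inner products as the only coefficients, later facts about [h_map] become rational
    identities that [field] can check. *)
Lemma h_mapE a x : h_map a x = (h_den a x)^-1 *:
  ((1 - 2 * dot a x + dot x x) *: a - (1 - dot a a) *: x).
Proof.
rewrite /h_map !sqr_enorm; congr (_^-1 *: _).
  by rewrite /h_den !dotE (dotC x a); ring.
rewrite !dotE (dotC x a) scalerBr addrA -scalerDl; congr (_ *: _ - _); ring.
Qed.

(** Otherwise 1 + |a|^2 |x|^2 <= 2 <a, x>; squaring and Cauchy-Schwarz would give (1 - |a|^2
    |x|^2)^2 <= 0, although |a| |x| < 1. *)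
Lemma h_den_gt0 a x : unit_ball a -> unit_ball x -> 0 < h_den a x.
Proof.
rewrite !unit_ballE /h_den => a1 x1.
have := dot_sqr_le a x; have := dot_ge0 a; have := dot_ge0 x.
move: (dot a a) (dot x x) (dot a x) a1 x1 => A X P A1 X1 X0 A0 PAX.
have AX : A * X < 1 by nra.
have AX0 : 0 <= A * X by nra.
rewrite ltNge; apply/negP => d0.
have : (1 + A * X) ^+ 2 <= (2 * P) ^+ 2.
  by rewrite ler_pXn2r// ?nnegrE; lra.
have : 0 < (1 - A * X) ^+ 2 by rewrite exprn_gt0// subr_gt0.
nra.
Qed.

(** Dividing the second identity by the first, taken at x and at y, cancels both denominators and
    leaves the invariance of [hyp_sep]. *)
Lemma h_map_dot a x y : h_den a x != 0 -> h_den a y != 0 ->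
  1 - dot (h_map a x) (h_map a x) =
    (1 - dot a a) * (1 - dot x x) / h_den a x /\
  dot (h_map a x - h_map a y) (h_map a x - h_map a y) =
    (1 - dot a a) ^+ 2 * dot (x - y) (x - y) / (h_den a x * h_den a y).
Proof.
rewrite !h_mapE /h_den !dotE (dotC x a) (dotC y a) (dotC y x).
move: (dot a a) (dot x x) (dot y y) (dot a x) (dot a y) (dot x y).
by move=> A X Y P Q S dx dy; split; field; rewrite ?dx ?dy.
Qed.

Lemma h_map_unit_ball a x : unit_ball a -> unit_ball x -> unit_ball (h_map a x).
Proof.
move=> a1 x1; have d0 := h_den_gt0 a1 x1.
have [+ _] := h_map_dot (lt0r_neq0 d0) (lt0r_neq0 d0).
move: a1 x1; rewrite !unit_ballE -subr_gt0 => a1; rewrite -subr_gt0 => x1.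
by rewrite -[in X in _ -> X]subr_gt0 => ->; rewrite divr_gt0 ?mulr_gt0.
Qed.

Lemma h_mapx0 a : h_map a 0 = a.
Proof.
by rewrite h_mapE /h_den !dot0r scaler0 !(mulr0, subr0, addr0) invr1 !scale1r.
Qed.

Lemma h_mapxx a : h_map a a = 0.
Proof. by rewrite /h_map subrr !sqr_enorm dot0l !(scale0r, scaler0, add0r). Qed.

Lemma h_map_involutive a x : unit_ball a -> unit_ball x ->
  h_map a (h_map a x) = x.
Proof.
move=> a1 x1; have /lt0r_neq0 d0 := h_den_gt0 a1 x1.
have A0 : 1 - dot a a != 0 by move: a1; rewrite unit_ballE -subr_gt0 => /lt0r_neq0.
(* The denominators at x and at h_a(x) have product (1 - |a|^2)^2. *)
have denE : h_den a (h_map a x) = (1 - dot a a) ^+ 2 / h_den a x.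
  move: d0; rewrite h_mapE /h_den !dotE (dotC x a).
  by move: (dot a a) (dot x x) (dot a x) => A X P d0; field.
have numE : 1 - 2 * dot a (h_map a x) + dot (h_map a x) (h_map a x) =
    (1 - dot a a) * (1 - 2 * dot a x + dot x x) / h_den a x.
  move: d0; rewrite h_mapE /h_den !dotE (dotC x a).
  by move: (dot a a) (dot x x) (dot a x) => A X P d0; field.
rewrite h_mapE denE numE h_mapE.
apply/rowP => j; rewrite !mxE.
move: (dot a a) (dot x x) (dot a x) (h_den a x) A0 d0 => A X P d A0 d0.
by field; rewrite d0 A0.
Qed.

(* sinh^2 (d / 2), where d is the hyperbolic distance between x and y. *)
Definition hyp_sep x y : R :=
  dot (x - y) (x - y) / ((1 - dot x x) * (1 - dot y y)).

Definition hyp_isometry g :=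
  (forall x, unit_ball x -> unit_ball (g x)) /\
  (forall x y, unit_ball x -> unit_ball y -> hyp_sep (g x) (g y) = hyp_sep x y).

(** The inverse is carried along because the estimates are applied to it too, and because it turns
    images of subsets of the ball into preimages. Both identities are confined to the ball, where
    [h_map] is under control. *)
Definition hyp_inverse g g' := [/\ hyp_isometry g, hyp_isometry g',
  forall x, unit_ball x -> g' (g x) = x & forall y, unit_ball y -> g (g' y) = y].

Lemma hyp_inverse_sym g g' : hyp_inverse g g' -> hyp_inverse g' g.
Proof. by case. Qed.

Lemma hyp_isometry_h_map a : unit_ball a -> hyp_isometry (h_map a).
Proof.
move=> a1; split => [x|x y x1 y1]; first exact: h_map_unit_ball.
have dx := lt0r_neq0 (h_den_gt0 a1 x1); have dy := lt0r_neq0 (h_den_gt0 a1 y1).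
have [hx hxy] := h_map_dot dx dy; have [hy _] := h_map_dot dy dx.
rewrite /hyp_sep hx hy hxy; move: a1 x1 y1 dx dy.
rewrite !unit_ballE -!(subr_gt0 _ 1) => /lt0r_neq0 + /lt0r_neq0 + /lt0r_neq0.
move: (dot (x - y) _) (dot a a) (dot x x) (dot y y) (h_den a x) (h_den a y).
by move=> S A X Y p q A1 X1 Y1 p0 q0; field; rewrite A1 X1 Y1 p0 q0.
Qed.

Lemma hyp_isometry_mulmx T : T *m T^T = 1%:M -> hyp_isometry (mulmx^~ T).
Proof.
move=> TT; split => [x|x y _ _]; first by rewrite !unit_ballE dot_mulmx_orthogonal.
by rewrite /hyp_sep -mulmxBl !dot_mulmx_orthogonal.
Qed.

Lemma hyp_inverse_mulmx T : T *m T^T = 1%:M ->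
  hyp_inverse (mulmx^~ T) (mulmx^~ T^T).
Proof.
move=> TT; split => [||x _|x _]; try exact: hyp_isometry_mulmx.
- exact/hyp_isometry_mulmx/orthogonal_trmx.
- by rewrite -mulmxA TT mulmx1.
- by rewrite -mulmxA (mulmx1C TT) mulmx1.
Qed.

Lemma hyp_inverse_image g g' A : hyp_inverse g g' -> A `<=` unit_ball ->
  g @` A = unit_ball `&` g' @^-1` A.
Proof.
move=> [gI g'I gK g'K] AB; apply/seteqP; split => [_ [x Ax <-]|y [y1 Ay]].
  by split => /=; [exact: gI.1 (AB _ Ax)|rewrite gK//; exact: AB].
by exists (g' y) => //; exact: g'K.
Qed.

Lemma hyp_isometry_comp f g : hyp_isometry f -> hyp_isometry g ->
  hyp_isometry (f \o g).
Proof.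
move=> [fB fI] [gB gI]; split => [x /gB/fB//|x y x1 y1] /=.
by rewrite fI ?gI//; apply: gB.
Qed.

(* The rows of T are the vectors 2 g(e_i / 2), as e_i is not in the ball. *)
Lemma hyp_isometry0 g : hyp_isometry g -> g 0 = 0 ->
  exists2 T, T *m T^T = 1%:M & forall x, unit_ball x -> g x = x *m T.
Proof.
move=> [gB gI] g0.
(* [hyp_sep x 0] is |x|^2 / (1 - |x|^2), which determines |x|^2. *)
have gn x : unit_ball x -> dot (g x) (g x) = dot x x.
  move=> x1; have := gI x 0 x1 (unit_ball0 _ _); have := gB x x1.
  move: x1; rewrite !unit_ballE -!(subr_gt0 _ 1) => x1 gx1.
  rewrite g0 /hyp_sep !subr0 !dot0l !subr0 !mulr1 => /eqP.
  by rewrite eqr_div ?lt0r_neq0// => /eqP; lra.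
(* Norms being preserved, equal values of [hyp_sep] mean equal distances, and polarization yields
   the inner products. *)
have gd x y : unit_ball x -> unit_ball y -> dot (g x) (g y) = dot x y.
  move=> x1 y1; have := gI x y x1 y1; rewrite /hyp_sep !gn//.
  move: x1 y1 (gn x x1) (gn y y1); rewrite !unit_ballE -!(subr_gt0 _ 1).
  move=> x1 y1 gx gy /divIf; rewrite mulf_neq0 ?lt0r_neq0// => /(_ isT).
  by rewrite !dotE gx gy (dotC (g y)) (dotC y); lra.
pose e (i : 'I_n) : 'rV[R]_n := 2^-1 *: delta_mx 0 i.
have dot_e x i : dot x (e i) = 2^-1 * x 0 i.
  rewrite dotZr /dot (bigD1 i)//= mxE !eqxx mulr1 big1 ?addr0// => j ji.
  by rewrite mxE (negbTE ji) andbF mulr0.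
have e1 i : unit_ball (e i).
  by rewrite unit_ballE dot_e /e !mxE !eqxx /=; lra.
pose T : 'M[R]_n := \matrix_(i, j) (2 * g (e i) 0 j).
have TT : T *m T^T = 1%:M.
  apply/matrixP => i k; rewrite !mxE.
  rewrite (eq_bigr (fun j => 4 * (g (e i) 0 j * g (e k) 0 j))); last first.
    by move=> j _; rewrite !mxE; ring.
  rewrite -mulr_sumr -/(dot _ _) gd// dot_e !mxE eqxx eq_sym.
  by case: eqP => _ /=; lra.
exists T => // x x1; rewrite -[LHS]mulmx1 -(mulmx1C TT) mulmxA; congr (_ *m T).
apply/rowP => i; rewrite !mxE.
rewrite (eq_bigr (fun j => 2 * (g x 0 j * g (e i) 0 j))); last first.
  by move=> j _; rewrite !mxE; ring.
by rewrite -mulr_sumr -/(dot _ _) gd// dot_e; lra.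
Qed.

Lemma hyp_isometry_normal_form g x : hyp_isometry g -> unit_ball x ->
  exists2 T, T *m T^T = 1%:M &
    forall z, unit_ball z -> h_map (g x) (g z) = h_map x z *m T.
Proof.
move=> gI x1; have gx1 := gI.1 x x1.
have [|T TT ghT] := hyp_isometry0 (hyp_isometry_comp
  (hyp_isometry_h_map gx1) (hyp_isometry_comp gI (hyp_isometry_h_map x1))).
  by rewrite /= h_mapx0 h_mapxx.
exists T => // z z1; rewrite -ghT/=; last exact: h_map_unit_ball.
by rewrite h_map_involutive.
Qed.

End Mobius.

(** * First-order expansion of hyperbolic isometries *)

Section FirstOrder.
Context (R : realType) (n : nat).
Implicit Types (u v w x y z a : 'rV[R]_n) (T : 'M[R]_n).
Implicit Types g : 'rV[R]_n -> 'rV[R]_n.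

(** The remainder is (1 - |y|^2) / d times (d - 1) w + |w|^2 y, where d = [h_den y w] satisfies d >=
    1/4 and |d - 1| <= 3 |w|. Hence the constant 16 = 4 (3 + 1), independent of y. *)
Lemma h_map_near0 y w : unit_ball y -> enorm w <= 4^-1 ->
  enorm (h_map y w - y + (1 - dot y y) *: w) <= 16 * enorm w ^+ 2.
Proof.
move=> y1 w4; have w0 := enorm_ge0 w; have y0 := enorm_ge0 y.
have y1' : enorm y < 1 by [].
have YE := sqr_enorm y; have WE := sqr_enorm w.
have := dot_le_enorm y w; rewrite ler_norml => /andP[yw1 yw2].
have yw3 : enorm y * enorm w <= enorm w by nra.
have YW0 : 0 <= enorm y ^+ 2 * enorm w ^+ 2 by rewrite mulr_ge0 ?sqr_ge0.
have YW1 : enorm y ^+ 2 * enorm w ^+ 2 <= enorm w.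
  rewrite -exprMn; have : 0 <= enorm y * enorm w by rewrite mulr_ge0.
  nra.
have d4 : 4^-1 <= h_den y w by rewrite /h_den -YE -WE; lra.
have d0 : 0 < h_den y w by lra.
have dw : `|h_den y w - 1| <= 3 * enorm w.
  by rewrite ler_norml /h_den -YE -WE; apply/andP; split; lra.
have -> : h_map y w - y + (1 - dot y y) *: w =
    ((1 - dot y y) / h_den y w) *: ((h_den y w - 1) *: w + dot w w *: y).
  rewrite h_mapE; apply/rowP => j; rewrite !mxE; move/lt0r_neq0: d0.
  rewrite /h_den; move: (dot y y) (dot w w) (dot y w) => Y W P d0.
  by field.
rewrite enormZ ger0_norm; last first.
  by apply: divr_ge0; [rewrite -YE; nra|exact: ltW].
apply: (@le_trans _ _ (4 * (4 * enorm w ^+ 2))); last by lra.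
apply: ler_pM; rewrite ?enorm_ge0//.
- by apply: divr_ge0; [rewrite -YE; nra|exact: ltW].
- by rewrite ler_pdivrMr//; have := dot_ge0 y; lra.
- apply: le_trans (enormD_le _ _) _; rewrite !enormZ.
  rewrite (ger0_norm (dot_ge0 w)) -WE.
  have := normr_ge0 (h_den y w - 1); nra.
Qed.

(** With v = u / (1 - |x|^2), the vector on the left is the remainder of [h_map_near0] for h_x at v,
    divided by 1 - |x|^2. This explains the cube in the constant. *)
Lemma h_map_near_center x u : unit_ball x -> enorm u <= (1 - dot x x) / 4 ->
  enorm (h_map x (x + u) + (1 - dot x x)^-1 *: u) <=
    16 / (1 - dot x x) ^+ 3 * enorm u ^+ 2.
Proof.
move=> x1 ux; have s0 : 0 < 1 - dot x x by rewrite subr_gt0 -unit_ballE.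
have s0' := lt0r_neq0 s0.
pose v := (1 - dot x x)^-1 *: u.
have vE : enorm v = enorm u / (1 - dot x x).
  by rewrite enormZ mulrC gtr0_norm// invr_gt0.
have v4 : enorm v <= 4^-1 by rewrite vE ler_pdivrMr//; lra.
have v1 : unit_ball v by rewrite /unit_ball/=; lra.
have dv := lt0r_neq0 (h_den_gt0 x1 v1).
have -> : h_map x (x + u) + (1 - dot x x)^-1 *: u =
    (1 - dot x x)^-1 *: (h_map x v - x + (1 - dot x x) *: v).
  move: dv; rewrite !h_mapE /h_den !dotE (dotC u x) => dv.
  apply/rowP => j; rewrite !mxE; move: dv s0'.
  move: (dot x x) (dot u u) (dot x u) => X U P dv s0'.
  field; rewrite s0' /=.
  (* [h_den x (x + u)] is (1 - |x|^2)^2 times [h_den x v], so it does not vanish. *)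
  apply: contra_neq dv => dv; apply: (mulfI (expf_neq0 2 s0')).
  by rewrite mulr0 -[RHS]dv; field.
rewrite enormZ gtr0_norm ?invr_gt0// mulrC ler_pdivrMr//.
apply: le_trans (h_map_near0 x1 v4) _; rewrite vE le_eqVlt; apply/orP; left.
by apply/eqP; field.
Qed.

(** Near x, g is h_(g x) o T o h_x; the expansion of h_x at x is composed with that of h_(g x) at 0.
    The factors -1 / (1 - |x|^2) and -(1 - |g x|^2) of their linear parts multiply to the conformal
    factor. *)
Lemma hyp_isometry_first_order g x : hyp_isometry g -> unit_ball x ->
  exists T (K d : R), [/\ T *m T^T = 1%:M, 0 < K, 0 < d &
    forall u, unit_ball (x + u) -> enorm u <= d ->
      enorm (g (x + u) - g x -
        ((1 - dot (g x) (g x)) / (1 - dot x x)) *: (u *m T)) <=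
      K * enorm u ^+ 2].
Proof.
move=> gI x1; have y1 := gI.1 x x1.
have [T0 TT0 gT0] := hyp_isometry_normal_form gI x1.
have s0 : 0 < 1 - dot x x by rewrite subr_gt0 -unit_ballE.
have s1 : 1 - dot x x <= 1 by have := dot_ge0 x; lra.
have t0 : 0 < 1 - dot (g x) (g x) by rewrite subr_gt0 -unit_ballE.
have t1 : 1 - dot (g x) (g x) <= 1 by have := dot_ge0 (g x); lra.
set s : R := 1 - dot x x in s0 s1 *.
set t : R := 1 - dot (g x) (g x) in t0 t1 *.
have si0 : 0 < s^-1 by rewrite invr_gt0.
(* The radius forces |v| <= 2 |u| / s <= 1/4 for v = h_x(x + u), so [h_map_near0] applies at v and
   16 |v|^2 <= 64 |u|^2 / s^2. The other term bounds the remainder of h_x, multiplied by t <= 1. *)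
exists T0, (64 / s ^+ 2 + 16 / s ^+ 3), (s ^+ 2 / 16); split => //.
- by rewrite addr_gt0// divr_gt0// exprn_gt0.
- by rewrite divr_gt0// exprn_gt0.
move=> u xu1 ud; have u0 := enorm_ge0 u.
pose v := h_map x (x + u).
have rE : enorm (v + s^-1 *: u) <= 16 / s ^+ 3 * enorm u ^+ 2.
  apply: h_map_near_center => //; apply: le_trans ud _; rewrite -/s.
  have : s ^+ 2 <= s by rewrite expr2 ler_piMl// ltW.
  by lra.
have v2 : enorm v <= 2 * (enorm u / s).
  have -> : v = (v + s^-1 *: u) - s^-1 *: u by rewrite addrK.
  apply: le_trans (enormD_le _ _) _; rewrite enormN enormZ gtr0_norm//.
  rewrite (_ : 2 * _ = enorm u / s + s^-1 * enorm u); last by ring.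
  rewrite lerD2r; apply: le_trans rE _.
  rewrite [leLHS](_ : _ = (16 * enorm u / s ^+ 2) * (enorm u / s)); last first.
    by field; exact: lt0r_neq0.
  rewrite -[leRHS]mul1r ler_wpM2r//; first by rewrite divr_ge0// ltW.
  by rewrite ler_pdivrMr ?exprn_gt0//; lra.
have v4 : enorm (v *m T0) <= 4^-1.
  rewrite enorm_orthogonal//; apply: le_trans v2 _.
  by rewrite mulrA ler_pdivrMr//; nra.
have gE : g (x + u) = h_map (g x) (v *m T0).
  by rewrite -gT0// h_map_involutive//; exact: gI.1.
have -> : g (x + u) - g x - (t / s) *: (u *m T0) =
    (h_map (g x) (v *m T0) - g x + t *: (v *m T0)) -
    t *: ((v + s^-1 *: u) *m T0).
  rewrite gE; clear; move: v s t (g x) (h_map (g x) _) => v' s t y q.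
  rewrite mulmxDl -scalemxAl; move: (v' *m T0) (u *m T0) => p r.
  by apply/rowP => j; rewrite !mxE; ring.
apply: le_trans (enormD_le _ _) _; rewrite mulrDl; apply: lerD.
  apply: le_trans (h_map_near0 y1 v4) _; rewrite enorm_orthogonal//.
  have -> : 64 / s ^+ 2 * enorm u ^+ 2 = 16 * (2 * (enorm u / s)) ^+ 2.
    by field; exact: lt0r_neq0.
  rewrite ler_pM2l// ler_pXn2r// nnegrE ?enorm_ge0//.
  by rewrite mulr_ge0// divr_ge0// ltW.
rewrite enormN enormZ gtr0_norm// enorm_orthogonal//.
apply: le_trans rE; have := enorm_ge0 (v + s^-1 *: u); nra.
Qed.

End FirstOrder.

(** * Lebesgue outer measure and dyadic cubes *)

Section LebesgueOuter.
Context (R : realType) (n : nat).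
Implicit Types (A B X : set 'rV[R]_n) (a b v t x : 'rV[R]_n).
Local Notation mu := (@lebesgue_outer R n).

Lemma lebesgue_outer_box F : (mu (box_set F) <= (box_volume F)%:E)%E.
Proof.
apply: ereal_inf_lbound; exists (fun k => if k == 0%N then F else None).
  by move=> x Fx; exists 0%N.
rewrite (nneseries_split 0 1) => [|k _]; last first.
  by rewrite lee_fin; exact: box_volume_ge0.
by rewrite big_nat1 eseries0 ?adde0// => -[].
Qed.

Definition diag_affine t v x : 'rV[R]_n := \row_j (t 0 j * x 0 j + v 0 j).

Lemma lebesgue_outer_diag_affine t v A : (forall j, 0 < t 0 j) ->
  (mu (diag_affine t v @` A) <= (\prod_j t 0 j)%:E * mu A)%E.
Proof.
move=> t0; have p0 : 0 < \prod_j t 0 j by apply: prodr_gt0.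
rewrite -lee_pdivrMl//; apply: le_ereal_inf_tmp => _ [F AF <-].
rewrite lee_pdivrMl// -nneseriesZl; last first.
  by move=> k _; rewrite lee_fin; exact: box_volume_ge0.
apply: ereal_inf_lbound.
exists (fun k => if F k is Some (a, b) then
  Some (diag_affine t v a, diag_affine t v b) else None).
  move=> _ [x /AF[k _ Fkx] <-]; exists k => //; move: Fkx.
  case: (F k) => [[a b]|]//= Fx j; rewrite !mxE lerD2r ltrD2r.
  by rewrite ltr_pM2l// ler_pM2l//.
apply: eq_eseriesr => k _; rewrite -EFinM; congr EFin.
case: (F k) => [[a b]|] /=; last by rewrite mulr0.
rewrite -big_split/=; apply: eq_bigr => j _.
by rewrite !mxE maxr_pMr ?ltW// mulr0; congr Num.max; ring.
Qed.

Definition unit_cube : set 'rV[R]_n := box_set (Some (0, const_mx 1)).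

Lemma lebesgue_outer_cube_le a b : (forall j, a 0 j < b 0 j) ->
  (mu (box_set (Some (a, b))) <= (box_volume (Some (a, b)))%:E * mu unit_cube)%E.
Proof.
move=> ab; pose t : 'rV[R]_n := \row_j (b 0 j - a 0 j).
have t0 j : 0 < t 0 j by rewrite mxE subr_gt0.
have -> : box_volume (Some (a, b)) = \prod_j t 0 j.
  by apply: eq_bigr => j _; rewrite mxE; apply/max_r; rewrite subr_ge0 ltW.
apply: le_trans (lebesgue_outer_diag_affine a unit_cube t0).
apply: le_lebesgue_outer => x /= abx.
exists (\row_j ((x 0 j - a 0 j) / t 0 j)).
  move=> j; have := abx j; have := t0 j; rewrite !mxE => tj /andP[ax xb].
  by rewrite divr_gt0 ?subr_gt0//= ler_pdivrMr// mul1r lerD2r.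
apply/rowP => j; rewrite !mxE mulrC divfK ?subrK//.
by rewrite subr_eq0 gt_eqF.
Qed.

(* With kappa = mu unit_cube <= 1, scaling gives mu <= kappa * mu, whence
   kappa <= kappa ^ 2 and kappa is 0 or 1. This spares the compactness argument
   needed for kappa = 1: every later result is trivial when mu = 0. *)
Lemma lebesgue_outer_trivial_or_box :
  (forall A, mu A = 0%E) \/ mu unit_cube = 1%E.
Proof.
have cube1 : box_volume (Some (0 : 'rV[R]_n, const_mx 1)) = 1.
  by apply: big1 => j _; rewrite !mxE subr0; apply/max_r.
have : (mu unit_cube <= 1)%E.
  by have := lebesgue_outer_box (Some (0, const_mx 1)); rewrite cube1.
have := lebesgue_outer_ge0 unit_cube.
case E : (mu unit_cube) => [k| |]//; rewrite !lee_fin => k0 k1.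
have le_k F : (mu (box_set F) <= k%:E * (box_volume F)%:E)%E.
  case: F => [[a b]|]; last by rewrite mule0 lebesgue_outer0.
  have [/forallP ab|/existsP[j]] := boolP [forall j, a 0 j < b 0 j].
    by rewrite muleC -E; exact: lebesgue_outer_cube_le.
  rewrite -leNgt => baj; rewrite (_ : box_set _ = set0).
    rewrite lebesgue_outer0 mule_ge0 ?lee_fin//.
    exact: (box_volume_ge0 (Some (a, b))).
  apply/seteqP; split => // x /= /(_ j)/andP[/lt_le_trans/[apply]].
  by rewrite ltNge baj.
have mu_le A : (mu A <= k%:E * mu A)%E.
  have [k00|k00] := eqVneq k 0; last first.
    rewrite -lee_pdivrMl ?lt_neqAle 1?eq_sym ?k00//.
    apply: le_ereal_inf_tmp => _ [F AF <-].
    rewrite lee_pdivrMl ?lt_neqAle 1?eq_sym ?k00// -nneseriesZl; last first.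
      by move=> i _; rewrite lee_fin; exact: box_volume_ge0.
    apply: le_trans (le_lebesgue_outer AF) _.
    apply: le_trans (lebesgue_outer_sigma_subadditive _) _.
    by apply: lee_nneseries => // i _ _; exact: lebesgue_outer_ge0.
  (* Case kappa = 0: every box is null, and the cubes ]-m, m]^n with m a natural number cover the
     space, so every set is null. *)
  have covT : box_cover A (fun i => if unpickle i is Some m then
      Some (const_mx (- m%:R), const_mx m%:R) else None).
    move=> x _; pose N := (\sum_(j < n) (Num.truncn `|x 0%R j|%R).+1)%N.
    exists (pickle N) => //; rewrite pickleK /= => j; rewrite !mxE.
    have : `|x 0 j| < N%:R.
      apply: lt_le_trans (truncnS_gt _) _.
      by rewrite ler_nat /N (bigD1 j)//= leq_addr.
    by rewrite ltr_norml => /andP[-> /ltW->].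
  rewrite k00 mul0e; apply: le_trans (le_lebesgue_outer covT) _.
  apply: le_trans (lebesgue_outer_sigma_subadditive _) _.
  rewrite eseries0// => i _ _; apply/eqP; rewrite eq_le lebesgue_outer_ge0 andbT.
  by apply: le_trans (le_k _) _; rewrite k00 mul0e.
have [k1E|k1'] := eqVneq k 1; first by right; rewrite k1E.
left => A; have : k = 0.
  have := mu_le unit_cube; rewrite E -EFinM lee_fin.
  by have := lt_neqAle k 1; rewrite k1' k1/=; nra.
move=> k00; apply/eqP; rewrite eq_le lebesgue_outer_ge0 andbT.
by have := mu_le A; rewrite k00 mul0e.
Qed.

(** For the lower bound, the diagonal map that shrinks the box to the unit cube multiplies outer
    measure by at most the inverse of the volume. *)
Lemma lebesgue_outer_box_eq a b : mu unit_cube = 1%E ->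
  (forall j, a 0 j < b 0 j) ->
  mu (box_set (Some (a, b))) = (box_volume (Some (a, b)))%:E.
Proof.
move=> mu1 ab; apply/eqP; rewrite eq_le lebesgue_outer_box andTb.
pose t : 'rV[R]_n := \row_j (b 0 j - a 0 j)^-1.
have t0 j : 0 < t 0 j by rewrite mxE invr_gt0 subr_gt0.
have -> : box_volume (Some (a, b)) = (\prod_j t 0 j)^-1.
  rewrite -prodfV; apply: eq_bigr => j _; rewrite mxE invrK; apply/max_r.
  by rewrite subr_ge0 ltW.
have p0 : 0 < \prod_j t 0 j by apply: prodr_gt0.
rewrite -[leLHS]mule1 lee_pdivrMl// -mu1.
pose v : 'rV[R]_n := \row_j (- a 0 j / (b 0 j - a 0 j)).
apply: le_trans (lebesgue_outer_diag_affine v _ t0).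
apply: le_lebesgue_outer => x /= cx.
exists (\row_j (a 0 j + x 0 j * (b 0 j - a 0 j))).
  move=> j; have := cx j; have := ab j; rewrite !mxE => tj /andP[ax xb].
  by apply/andP; split; nra.
apply/rowP => j; rewrite !mxE; field.
by rewrite subr_eq0 gt_eqF.
Qed.

End LebesgueOuter.

(** * Caratheodory measurability of boxes *)

Section BoxMeasurable.
Context (R : realType) (n : nat).
Implicit Types (A B X U : set 'rV[R]_n) (a b v t x y : 'rV[R]_n).
Local Notation mu := (@lebesgue_outer R n).

(** The hyperplane x_j = t cuts each half-open box of a cover into two half-open boxes, possibly
    empty, whose volumes add up to that of the box. One family covers the part of X inside the
    half-space, the other the part outside. *)
Lemma halfspace_measurable (j : 'I_n) (t : R) :
  lebesgue_measurable [set x : 'rV[R]_n | x 0 j <= t].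
Proof.
apply: le_caratheodory_measurable => X; apply: le_ereal_inf_tmp => _ [F XF <-].
pose upd a (s : R) : 'rV[R]_n := \row_i (if i == j then s else a 0 i).
pose F1 k := if F k is Some (a, b) then Some (a, upd b (Num.min (b 0 j) t))
  else None.
pose F2 k := if F k is Some (a, b) then Some (upd a (Num.max (a 0 j) t), b)
  else None.
rewrite (_ : (\sum_(k <oo) _ = \sum_(k <oo) (box_volume (F1 k))%:E +
    \sum_(k <oo) (box_volume (F2 k))%:E)%E); last first.
  rewrite -nneseriesD => [|k _ _|k _ _]; last 2 first.
  - by rewrite lee_fin box_volume_ge0.
  - by rewrite lee_fin box_volume_ge0.
  apply: eq_eseriesr => k _; rewrite -EFinD; congr EFin; rewrite /F1 /F2.
  case: (F k) => [[a b]|] /=; last by rewrite addr0.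
  rewrite (bigD1 j)//= [in X in _ = X + _](bigD1 j)//=.
  rewrite [in X in _ = _ + X](bigD1 j)//= !mxE eqxx.
  rewrite [X in _ = _ * X + _](eq_bigr (fun i => Num.max 0 (b 0 i - a 0 i)));
    last by move=> i /negbTE ij; rewrite mxE ij.
  rewrite [X in _ = _ + _ * X](eq_bigr (fun i => Num.max 0 (b 0 i - a 0 i)));
    last by move=> i /negbTE ij; rewrite mxE ij.
  rewrite -mulrDl; congr (_ * _).
  rewrite /Num.max /Num.min; do ?case: ifPn; rewrite -?leNgt; lra.
apply: leeD; apply: ereal_inf_lbound.
- exists F1 => // x [/XF[k _ Fkx] xt]; exists k => //; move: Fkx.
  rewrite /F1; case: (F k) => [[a b]|]//= abx i; rewrite mxE.
  by case: eqP => // ->; rewrite le_min xt andbT.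
- exists F2 => // x [/XF[k _ Fkx] /= /negP xt]; exists k => //; move: Fkx.
  rewrite /F2; case: (F k) => [[a b]|]//= abx i; rewrite mxE.
  case: eqP => // ->; have /andP[ax xb] := abx j.
  by rewrite gt_max ax xb andbT/= ltNge.
Qed.

Lemma box_measurable F : lebesgue_measurable (@box_set R n F).
Proof.
case: F => [[a b]|]; last exact: measurable0.
rewrite /lebesgue_measurable.
have -> : box_set (Some (a, b)) =
  \bigcap_(j in [set: 'I_n])
    ([set x : lebesgueRn R n | x 0 j <= b 0 j] `\`
     [set x : lebesgueRn R n | x 0 j <= a 0 j]).
  apply/seteqP; split => [x abx j _|x abx j] /=.
    have /andP[ax xb] := abx j; split => //.
    by move=> /(lt_le_trans ax); rewrite ltxx.
  by have [/= -> /negP] := abx j I; rewrite -ltNge => ->.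
apply: fin_bigcap_measurable => // j _.
by apply: measurableD; exact: halfspace_measurable.
Qed.

End BoxMeasurable.

(** * Dyadic cubes and open sets *)

Section Dyadic.
Context (R : realType) (n : nat).
Implicit Types (A B X U : set 'rV[R]_n) (a b v t x y : 'rV[R]_n).
Implicit Types (k l : nat) (z : 'rV[int]_n).
Local Notation mu := (@lebesgue_outer R n).
Local Notation index := (nat * 'rV[int]_n)%type.

(** The ceiling fits boxes that are open on the left and closed on the right: z indexes the product
    of the intervals ](z_j - 1) / 2^k, z_j / 2^k]. *)
Definition dyadic_cell k x : 'rV[int]_n := \row_j Num.ceil (2 ^+ k * x 0 j).

Definition dyadic_box (q : index) : 'rV[R]_n * 'rV[R]_n :=
  (\row_j ((q.2 0 j - 1)%:~R / 2 ^+ q.1), \row_j ((q.2 0 j)%:~R / 2 ^+ q.1)).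

(** [None] gives the empty set, so that a family of cubes can be listed as a sequence with gaps. *)
Definition dyadic_cube (o : option index) : set 'rV[R]_n :=
  box_set (omap dyadic_box o).

Lemma dyadic_cubeP k z x : dyadic_cube (Some (k, z)) x <-> dyadic_cell k x = z.
Proof.
have k0 : 0 < (2 : R) ^+ k by rewrite exprn_gt0.
split => /= [xz|<- j]; last first.
  by rewrite !mxE ltr_pdivrMr// ler_pdivlMr// mulrC; exact/real_ceil_itv/num_real.
apply/rowP => j; rewrite mxE; apply: ceil_def; have := xz j.
by rewrite !mxE ltr_pdivrMr// ler_pdivlMr// mulrC.
Qed.

(** An integer is determined by its upper bounds, and ceil(2^k s) <= m holds iff ceil(2^l s) <= 2^(l
    - k) m. *)
Lemma dyadic_cell_coarser k l x y : (k <= l)%N ->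
  dyadic_cell l x = dyadic_cell l y -> dyadic_cell k x = dyadic_cell k y.
Proof.
move=> kl xy; apply/rowP => j; rewrite !mxE.
have /rowP/(_ j) := xy; rewrite !mxE => cxy.
have le_iff (m : int) (s : R) :
    (Num.ceil (2 ^+ k * s) <= m) = (Num.ceil (2 ^+ l * s) <= 2 ^+ (l - k) * m).
  rewrite !ceil_le_int intrM rmorphXn/= -(subnKC kl) addKn exprD -mulrA.
  by rewrite [X in _ = (X <= _)]mulrCA ler_pM2l// exprn_gt0.
apply/eqP; rewrite eq_le; apply/andP; split.
  by rewrite le_iff cxy -le_iff.
by rewrite le_iff -cxy -le_iff.
Qed.

Lemma dyadic_cube_measurable o : lebesgue_measurable (dyadic_cube o).
Proof. exact: box_measurable. Qed.

Lemma dyadic_cube_diam k z x y j :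
  dyadic_cube (Some (k, z)) x -> dyadic_cube (Some (k, z)) y ->
  `|x 0 j - y 0 j| < 2 ^- k.
Proof.
move=> /= /(_ j) + /(_ j); rewrite !mxE intrB mulrBl mul1r.
by rewrite ltr_norml; lra.
Qed.

(* The witnesses are the good cubes that are contained in no larger good
   cube. *)
Lemma dyadic_decomposition (good : index -> Prop) A :
  (forall x, A x -> exists k, good (k, dyadic_cell k x)) ->
  exists F : nat -> option index,
    [/\ forall i q, F i = Some q -> good q,
        A `<=` \bigcup_i dyadic_cube (F i) &
        trivIset setT (dyadic_cube \o F)].
Proof.
move=> Agood.
pose maxi q := good q /\ forall l x, dyadic_cube (Some q) x -> (l < q.1)%N ->
  ~ good (l, dyadic_cell l x).
pose F i := if @pickle_inv index i is Some q then
  if `[< maxi q >] then Some q else None else None.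
have FP i q : F i = Some q -> pickle q = i /\ maxi q.
  rewrite /F; have := @pickle_invK index i.
  by case: pickle_inv => //= p <-; case: asboolP => // mp [<-].
exists F; split => [i q /FP[_ []]//|x /Agood|i j _ _ [x [/=]]].
  move=> /cid[k gk]; have ex : exists k, `[< good (k, dyadic_cell k x) >].
    by exists k; exact/asboolP.
  (* The least good level at x gives a maximal good cube, because all points of that cube share
     their coarser cells with x. *)
  have [m /asboolP gm mmin] := ex_minnP ex.
  exists (pickle (m, dyadic_cell m x)) => //; rewrite /F pickleK_inv.
  rewrite asboolT; first exact/dyadic_cubeP.
  split => // l y /dyadic_cubeP/= yx lm /asboolP; apply/negP.
  rewrite (@dyadic_cell_coarser l m y x)//; last exact: ltnW.
  by apply: contraL lm => /mmin; rewrite leqNgt.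
have FS i' : dyadic_cube (F i') x -> exists q, F i' = Some q.
  by case: (F i') => // q _; exists q.
move=> ix jx; have [p ip] := FS _ ix; have [q jq] := FS _ jx.
have [<- [gp minp]] := FP _ _ ip; have [<- [gq minq]] := FP _ _ jq.
move: ix jx; rewrite ip jq; clear -gp gq minp minq.
case: p gp minp => k z; case: q gq minq => l w /= gq minq gp minp zx wx.
have zE := (dyadic_cubeP k z x).1 zx; have wE := (dyadic_cubeP l w x).1 wx.
(* Two selected cubes through x have the same level: otherwise the larger one would be a good cube
   that contradicts the maximality of the smaller. *)
suff kl : k = l by rewrite -zE -wE kl.
apply/eqP; rewrite eqn_leq; apply/andP; split; rewrite leqNgt; apply/negP.
  by move=> /(minp l x zx); rewrite wE.
by move=> /(minq k x wx); rewrite zE.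
Qed.

Lemma pow2V_lt (e : R) : 0 < e -> exists k, forall l, (k <= l)%N -> 2 ^- l < e.
Proof.
move=> e0; exists (Num.truncn e^-1).+1 => l kl.
apply: (@le_lt_trans _ _ (2 ^- (Num.truncn e^-1).+1)).
  by rewrite lef_pV2 ?posrE ?exprn_gt0// ler_weXn2l// ler1n.
rewrite invf_plt ?posrE ?exprn_gt0//; apply: lt_trans (truncnS_gt _) _.
by rewrite -natrX ltr_nat ltn_expl.
Qed.

Lemma open_dyadic U x : open U -> U x ->
  exists k, forall l, (k <= l)%N ->
    dyadic_cube (Some (l, dyadic_cell l x)) `<=` U.
Proof.
move=> oU Ux; have /nbhs_ballP[e /= e0 eU] := open_nbhs_nbhs (conj oU Ux).
have [k ke] := pow2V_lt e0; exists k => l kl y ly; apply: eU.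
split => // i j; rewrite !ord1.
apply: lt_trans (dyadic_cube_diam j _ ly) (ke l kl).
exact/dyadic_cubeP.
Qed.

Lemma open_lebesgue_measurable U : open U -> lebesgue_measurable U.
Proof.
move=> oU; have [F [Fgood UF _]] :=
  @dyadic_decomposition (fun q => dyadic_cube (Some q) `<=` U) U
    (fun x Ux => let: ex_intro k kU := open_dyadic oU Ux in
                 ex_intro _ k (kU k (leqnn k))).
have -> : U = \bigcup_i dyadic_cube (F i).
  apply/seteqP; split => // x [i _].
  by case E : (F i) => [q|]// qx; exact: Fgood E _ qx.
by apply: bigcup_measurable => i _; exact: dyadic_cube_measurable.
Qed.

End Dyadic.

(** * Continuity, measurability, orthogonal invariance *)

Section Topology.
Context (R : realType) (n : nat).
Implicit Types (A B X U : set 'rV[R]_n) (x y z : 'rV[R]_n).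
Implicit Types g : 'rV[R]_n -> 'rV[R]_n.

Lemma near_enorm x (d : R) : 0 < d -> \forall z \near x, enorm (z - x) < d.
Proof.
(* The balls are those of the sup norm, which costs a factor n; dividing by n + 1 also covers n =
   0. *)
move=> d0; apply/nbhs_ballP; exists (d / n.+1%:R) => /=; first by rewrite divr_gt0.
move=> z [_ /(_ 0) xz]; apply: (@le_lt_trans _ _ (n%:R * (d / n.+1%:R))).
  apply: enorm_le_coord => [|j]; first by rewrite divr_ge0// ltW.
  by have := xz j; rewrite !mxE distrC => /ltW.
by rewrite mulrCA gtr_pMr// ltr_pdivrMr// mul1r ltr_nat.
Qed.

Lemma open_unit_ball : open (@unit_ball R n).
Proof.
rewrite openE => x x1; have : 0 < 1 - enorm x by rewrite subr_gt0.
move=> /(near_enorm x); apply: filterS => z zx; rewrite /unit_ball/=.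
have -> : z = (z - x) + x by rewrite subrK.
apply: le_lt_trans (enormD_le _ _) _; lra.
Qed.

Lemma enorm_continuous : continuous (@enorm R n).
Proof.
move=> x; apply/(@cvgrPdist_lt _ _ _ (nbhs x)) => e e0.
have := near_enorm x e0; apply: filterS => z.
apply: le_lt_trans; rewrite ler_norml.
have := enormD_le (z - x) x; have := enormD_le (x - z) z.
by rewrite -(enormN (x - z)) opprB !subrK; lra.
Qed.

Lemma hyp_density_continuous x : unit_ball x ->
  {for x, continuous (@hyp_density R n)}.
Proof.
move=> x1; apply: (@continuous_comp _ _ _ (@enorm R n)
  (fun t : R => (1 - t ^+ 2) ^- n)); first exact: enorm_continuous.
apply: cvgV.
  by rewrite expf_neq0// subr_eq0 eq_sym lt_eqF// sqr_enorm -unit_ballE.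
apply: (@continuous_comp _ _ _ (fun t : R => 1 - t ^+ 2) (fun t : R => t ^+ n)).
  by apply: cvgB; [exact: cvg_cst|exact: exprn_continuous].
exact: exprn_continuous.
Qed.

Lemma hyp_isometry_continuous g x j : hyp_isometry g -> unit_ball x ->
  {for x, continuous (fun z => g z 0 j)}.
Proof.
move=> gI x1; have [T [K [d [TT K0 d0 gT]]]] := hyp_isometry_first_order gI x1.
set s : R := (_ / _) in gT.
apply/(@cvgrPdist_lt _ _ _ (nbhs x)) => e e0.
have c0 : 0 < `|s| + K + 1 by have := normr_ge0 s; lra.
(* For |z - x| <= 1 the quadratic remainder is at most K |z - x|, so that |g z - g x| <= (|s| + K)
   |z - x|. *)
have m0 : 0 < Num.min (Num.min d 1) (e / (`|s| + K + 1)).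
  by rewrite !lt_min d0 ltr01 divr_gt0.
have := near_enorm x m0; apply: filterS2 (open_nbhs_nbhs (conj open_unit_ball x1)).
move=> z z1; rewrite !lt_min => /andP[/andP[zd zu] ze].
have xz : z = x + (z - x) by rewrite addrC subrK.
have := gT (z - x); rewrite -xz => /(_ z1 (ltW zd)) gz.
have -> : g x 0 j - g z 0 j = (g x - g z) 0 j by rewrite !mxE.
apply: le_lt_trans (coord_le_enorm _ _) _.
rewrite -enormN opprB -[X in enorm X](subrK (s *: ((z - x) *m T))).
apply: le_lt_trans (enormD_le _ _) _.
rewrite enormZ enorm_orthogonal//.
move: ze; rewrite ltr_pdivlMr//; have := enorm_ge0 (z - x).
have : K * enorm (z - x) ^+ 2 <= K * enorm (z - x).
  by rewrite ler_pM2l// expr2 ler_piMl ?enorm_ge0// ltW.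
lra.
Qed.

Lemma continuous_lebesgue_measurable U (f : 'rV[R]_n -> R) : open U ->
  (forall x, U x -> {for x, continuous f}) ->
  measurable_fun (U : set (lebesgueRn R n)) (f : lebesgueRn R n -> R).
Proof.
move=> oU cf; apply: (measurability _ (RGenOInfty.measurableE R)).
move=> _ [_ [a ->] <-]; apply: open_lebesgue_measurable.
rewrite openE => x [Ux]; rewrite /= in_itv/= andbT => afx.
apply: filterS2 (open_nbhs_nbhs (conj oU Ux))
  (@cvgr_gt _ _ (nbhs x) _ _ _ (cf x Ux) _ afx).
by move=> z Uz az; split => //=; rewrite in_itv/= andbT.
Qed.

Lemma box_preimage_measurable U g F :
  measurable (U : set (lebesgueRn R n)) ->
  (forall j, measurable_fun (U : set (lebesgueRn R n))
    ((fun x => g x 0 j) : lebesgueRn R n -> R)) ->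
  lebesgue_measurable (U `&` g @^-1` box_set F).
Proof.
move=> mU mg; rewrite /lebesgue_measurable; case: F => [[a b]|]; last first.
  by rewrite preimage_set0 setI0; exact: measurable0.
have -> : U `&` g @^-1` box_set (Some (a, b)) = U `&` \bigcap_(j in [set: 'I_n])
    (U `&` (fun x => g x 0 j) @^-1` `]a 0 j, b 0 j]).
  apply/seteqP; split => [x [Ux /= abx]|x [Ux abx]]; split => // j.
    by move=> _; split => //=; rewrite in_itv/=.
  by have [_ /=] := abx j I; rewrite in_itv.
apply: measurableI => //; apply: fin_bigcap_measurable => // j _.
by apply: mg => //; exact: measurable_itv.
Qed.

Lemma hyp_isometry_measurable g j : hyp_isometry g ->
  measurable_fun (@unit_ball R n : set (lebesgueRn R n))
    ((fun x => g x 0 j) : lebesgueRn R n -> R).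
Proof.
move=> gI; apply: continuous_lebesgue_measurable; first exact: open_unit_ball.
by move=> x x1; exact: hyp_isometry_continuous.
Qed.

End Topology.

(** * Scaling and outer regularity *)

Section Regularity.
Context (R : realType) (n : nat).
Implicit Types (A B X U : set 'rV[R]_n) (a b v x y z : 'rV[R]_n) (T : 'M[R]_n).
Implicit Types g : 'rV[R]_n -> 'rV[R]_n.
Local Notation mu := (@lebesgue_outer R n).

Lemma lebesgue_outer_affine (s : R) v A : 0 < s ->
  (mu ((fun x => s *: x + v)%R @` A) <= (s ^+ n)%:E * mu A)%E.
Proof.
move=> s0; have := @lebesgue_outer_diag_affine R n (const_mx s) v A.
rewrite (eq_bigr (fun=> s)) => [|j _]; last by rewrite mxE.
rewrite prodr_const card_ord => H; apply: le_trans (H _); last first.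
  by move=> j; rewrite mxE.
apply: le_lebesgue_outer => _ [x Ax <-]; exists x => //.
by apply/rowP => j; rewrite !mxE.
Qed.

Lemma dyadic_cube_volume q : box_volume (Some (@dyadic_box R n q)) = (2 ^- q.1) ^+ n.
Proof.
rewrite /= (eq_bigr (fun=> 2 ^- q.1)) ?prodr_const ?card_ord// => j _.
rewrite !mxE intrB mulrBl mul1r opprB addrC subrK; apply/max_r.
by rewrite invr_ge0 exprn_ge0.
Qed.

Lemma open_box a b : open [set x : 'rV[R]_n | forall j, a 0 j < x 0 j < b 0 j].
Proof.
rewrite openE => x abx; apply: (@filter_forall _ _ _ (nbhs x)) => j.
have /andP[ax xb] := abx j.
have cj : {for x, continuous (fun z : 'rV[R]_n => z 0 j)} by exact: coord_continuous.
apply: filterS2 (@cvgr_gt _ _ (nbhs x) _ _ _ cj _ ax)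
  (@cvgr_lt _ _ (nbhs x) _ _ _ cj _ xb) => z.
by move=> -> ->.
Qed.

(** A nonempty box is enlarged by moving its upper faces outward by t; the volume is a polynomial in
    t, hence close to the original one for small t > 0. *)
Lemma box_open_cover F (e : R) : 0 < e -> exists2 U, open U &
  box_set F `<=` U /\ (mu U <= (box_volume F + e)%:E)%E.
Proof.
move=> e0; have empty G : box_set G = set0 -> exists2 U, open U &
    box_set G `<=` U /\ (mu U <= (box_volume G + e)%:E)%E.
  move=> ->; exists set0; first exact: open0.
  split => //; rewrite lebesgue_outer0 lee_fin addr_ge0 ?(ltW e0)//.
  exact: box_volume_ge0.
case: F => [[a b]|]; last exact: empty.
have [/forallP ab|/existsP[j]] := boolP [forall j, a 0 j < b 0 j]; last first.
  rewrite -leNgt => baj; apply: empty; apply/seteqP; split => // x /= /(_ j).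
  by move=> /andP[/lt_le_trans/[apply]]; rewrite ltNge baj.
have vE (t : R) : 0 <= t ->
    box_volume (Some (a, b + const_mx t)) = \prod_j (b 0 j - a 0 j + t).
  move=> t0; apply: eq_bigr => j _; rewrite !mxE addrAC; apply/max_r.
  by rewrite addr_ge0// subr_ge0 ltW.
have vc : (fun t : R => \prod_(j < n) (b 0 j - a 0 j + t)) @ 0^'+ -->
    \prod_(j < n) (b 0 j - a 0 j + 0).
  apply: cvg_big => [|j _]; first exact: mul_continuous.
  by apply: cvgD; [exact: cvg_cst|apply: cvg_at_right_filter; exact: cvg_id].
have v0 : \prod_(j < n) (b 0 j - a 0 j + 0) = box_volume (Some (a, b)).
  by rewrite -(vE 0)//; congr box_volume; rewrite (_ : const_mx 0 = 0) ?addr0.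
rewrite v0 in vc; have ve : box_volume (Some (a, b)) < box_volume (Some (a, b)) + e.
  by rewrite ltrDl.
have [t [t0 tv]] : exists t, 0 < t /\
    \prod_(j < n) (b 0 j - a 0 j + t) < box_volume (Some (a, b)) + e.
  apply: (@filter_ex _ (0 : R)^'+); near=> t; split; last first.
    by near: t; exact: cvgr_lt vc _ ve.
  by near: t; exact: nbhs_right_gt.
exists [set x : 'rV[R]_n | forall j, a 0 j < x 0 j < (b + const_mx t) 0 j].
  exact: open_box.
split => [x /= abx j|].
  by have /andP[-> xb]/= := abx j; rewrite !mxE (le_lt_trans xb)// ltrDl.
apply: (@le_trans _ _ (mu (box_set (Some (a, b + const_mx t))))).
  by apply: le_lebesgue_outer => x /= abx j; have /andP[-> /ltW] := abx j.
apply: le_trans (lebesgue_outer_box _) _; rewrite lee_fin vE ?(ltW t0)//.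
exact: ltW.
Unshelve. all: by end_near. Qed.

(** Half of e pays for a nearly optimal box cover, the other half, split geometrically, for making
    its boxes open. *)
Lemma lebesgue_outer_regular A (e : R) : 0 < e -> exists2 U, open U &
  A `<=` U /\ (mu U <= mu A + e%:E)%E.
Proof.
move=> e0; have := lebesgue_outer_ge0 A.
case E : (mu A) => [r| |]// r0; last first.
  by exists setT; [exact: openT|rewrite leey].
have e2 : 0 < e / 2 by rewrite divr_gt0.
have [|_ [F AF <-] Fr] := lb_ereal_inf_adherent e2 (_ : mu A \is a fin_num).
  by rewrite E.
have /choice[U PU] : forall i, exists U, open U /\ box_set (F i) `<=` U /\
    (mu U <= (box_volume (F i) + e / 2 / (2 ^ i.+1)%:R)%:E)%E.
  move=> i; have [|U oU PU] := @box_open_cover (F i) (e / 2 / (2 ^ i.+1)%:R).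
    by rewrite divr_gt0.
  by exists U.
exists (\bigcup_i U i); first by apply: bigcup_open => i _; have [] := PU i.
split.
  by apply: subset_trans AF _; apply: subset_bigcup => i _; have [_ []] := PU i.
apply: le_trans (lebesgue_outer_sigma_subadditive _) _.
apply: (@le_trans _ _ (\sum_(i <oo)
    ((box_volume (F i))%:E + (e / 2 / (2 ^ i.+1)%:R)%:E))%E).
  apply: lee_nneseries => [i _ _|i _]; first exact: lebesgue_outer_ge0.
  by have [_ []] := PU i.
apply: le_trans (epsilon_trick _ _ (ltW e2)) _.
  by move=> i; rewrite lee_fin box_volume_ge0.
rewrite {2}(splitr e) EFinD addeA leeD2r// -E ltW//.
Qed.

End Regularity.

(** * Outer measure of images and orthogonal maps *)

Section Images.
Context (R : realType) (n : nat).
Implicit Types (A B X U : set 'rV[R]_n) (a b v x y z : 'rV[R]_n) (T : 'M[R]_n).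
Implicit Types g : 'rV[R]_n -> 'rV[R]_n.
Local Notation mu := (@lebesgue_outer R n).
Local Notation leb := (@lebesgue_measureRn R n).
Local Notation vol k := ((2 ^- k : R) ^+ n).

Lemma lebesgue_outer_bigcup (F : nat -> set 'rV[R]_n) :
  (forall i, lebesgue_measurable (F i)) -> trivIset setT F ->
  mu (\bigcup_i F i) = (\sum_(i <oo) mu (F i))%E.
Proof.
move=> mF tF; have := measure_bigcup leb setT F (fun i _ => mF i) tF.
by rewrite (eq_eseriesl (Q := xpredT))// => i; rewrite in_setT.
Qed.

Lemma lebesgue_outer_dyadic q : mu (@unit_cube R n) = 1%E ->
  mu (dyadic_cube (Some q)) = (vol q.1)%:E.
Proof.
move=> mu1; rewrite -dyadic_cube_volume -lebesgue_outer_box_eq// => j.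
by rewrite !mxE ltr_pM2r ?invr_gt0 ?exprn_gt0// ltr_int ltrBlDr ltzD1.
Qed.

Lemma dyadic_series_le (F : nat -> option (nat * 'rV[int]_n)) U :
  mu (@unit_cube R n) = 1%E -> trivIset setT (@dyadic_cube R n \o F) ->
  \bigcup_i dyadic_cube (F i) `<=` U ->
  (\sum_(i <oo) (if F i is Some q then vol q.1 else 0)%:E <= mu U)%E.
Proof.
move=> mu1 tF FU; apply: le_trans (le_lebesgue_outer FU).
rewrite lebesgue_outer_bigcup//; last first.
  by move=> i; exact: dyadic_cube_measurable.
apply: lee_nneseries => [i _ _|i _].
  by rewrite lee_fin; case: (F i) => [q|]//; rewrite exprn_ge0// invr_ge0 exprn_ge0.
case: (F i) => [q|]; last exact: lebesgue_outer_ge0.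
by rewrite lebesgue_outer_dyadic.
Qed.

(** This passes from a local bound to a global one: inside an open set of measure close to that of
    A, disjoint dyadic cubes that satisfy the bound cover A, and the bounds are summed. The
    admissible scale may vary with the point. *)
Lemma lebesgue_outer_image_le A g (M : R) : 0 <= M ->
  (forall x, A x -> exists k, forall l, (k <= l)%N ->
    (mu (g @` dyadic_cube (Some (l, dyadic_cell l x))) <= (M * vol l)%:E)%E) ->
  (mu (g @` A) <= M%:E * mu A)%E.
Proof.
move=> M0 Ag; case: (@lebesgue_outer_trivial_or_box R n) => [mu0|mu1].
  by rewrite !mu0 mule0.
suff H (e : R) : 0 < e -> (mu (g @` A) <= M%:E * (mu A + e%:E))%E.
  have := lebesgue_outer_ge0 A; case E : (mu A) H => [r| |]// H r0; last first.
    (* If A has infinite measure and M = 0, the right-hand side is 0 by the convention 0 * +oo = 0,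
       and [H] still shows that the image is null. *)
    have [M00|M00] := eqVneq M 0; last first.
      by rewrite gt0_muley ?leey// lte_fin lt_neqAle eq_sym M00.
    by have := H 1 ltr01; rewrite addye//= M00 mul0e.
  apply/lee_addgt0Pr => e e0; apply: le_trans (H (e / (M + 1)) _) _.
    by rewrite divr_gt0// ltr_wpDl.
  rewrite -EFinD -!EFinM -EFinD lee_fin mulrDr lerD2l mulrCA ger_pMr//.
  by rewrite ler_pdivrMr ?ltr_wpDl//; lra.
move=> e0; have [U oU [AU Ue]] := lebesgue_outer_regular A e0.
pose good (q : nat * 'rV[int]_n) := dyadic_cube (Some q) `<=` U /\
  (mu (g @` dyadic_cube (Some q)) <= (M * vol q.1)%:E)%E.
have [x Ax|F [Fgood AF tF]] := @dyadic_decomposition R n good A.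
  have [k Hk] := open_dyadic oU (AU x Ax); have [l Hl] := Ag x Ax.
  exists (maxn k l); split; first by apply: Hk; exact: leq_maxl.
  by apply: Hl; exact: leq_maxr.
apply: (@le_trans _ _ (\sum_(i <oo) M%:E *
    (if F i is Some q then vol q.1 else 0)%:E)%E); last first.
  rewrite nneseriesZl; last first.
    by move=> i _; rewrite lee_fin; case: (F i).
  rewrite lee_wpmul2l ?lee_fin//; apply: le_trans Ue.
  apply: dyadic_series_le => // x [i _].
  by case E : (F i) => [q|]//; have [+ _] := Fgood _ _ E; apply.
apply: (@le_trans _ _ (mu (\bigcup_i g @` dyadic_cube (F i)))).
  rewrite -image_bigcup; apply: le_lebesgue_outer; exact: image_subset.
apply: le_trans (lebesgue_outer_sigma_subadditive _) _.
apply: lee_nneseries => [i _ _|i _]; first exact: lebesgue_outer_ge0.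
case E : (F i) => [q|]; first by have [_] := Fgood _ _ E; rewrite EFinM.
by rewrite image_set0 lebesgue_outer0 mule0.
Qed.

(** The cube is the image of the unit cube under x |-> 2^-k x + v, and T carries this map to one
    with the same ratio. Scaling by this map and by its inverse gives the two inequalities. *)
Lemma dyadic_image_mulmx T k (z : 'rV[int]_n) :
  mu (mulmx^~ T @` dyadic_cube (Some (k, z))) =
  ((vol k)%:E * mu (mulmx^~ T @` @unit_cube R n))%E.
Proof.
have r0 : 0 < (2 ^- k : R) by rewrite invr_gt0 exprn_gt0.
pose v : 'rV[R]_n := \row_j ((z 0 j - 1)%:~R * 2 ^- k).
have E x : @unit_cube R n x <-> dyadic_cube (Some (k, z)) (2 ^- k *: x + v).
  have e j : (v 0 j < (2 ^- k *: x + v) 0 j <= v 0 j + 2 ^- k) = (0 < x 0 j <= 1).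
    rewrite !mxE ltrDr addrC lerD2l pmulr_rgt0//; congr (_ && _).
    by rewrite -[X in _ <= X]mulr1 ler_pM2l.
  have vE j : (dyadic_box R (k, z)).2 0 j = v 0 j + 2 ^- k.
    by rewrite !mxE intrB mulrBl mul1r subrK.
  have vE' j : (dyadic_box R (k, z)).1 0 j = v 0 j by rewrite !mxE.
  split => Q j; have := Q j; [rewrite vE vE' e|rewrite vE vE' e].
    by rewrite !mxE.
  by rewrite !mxE.
apply/eqP; rewrite eq_le; apply/andP; split.
  apply: le_trans (lebesgue_outer_affine (v *m T) _ r0).
  apply: le_lebesgue_outer => _ [x Qx <-].
  exists (((2 ^- k)^-1 *: (x - v)) *m T).
    exists ((2 ^- k)^-1 *: (x - v)) => //.
    apply/E; rewrite scalerA divff ?lt0r_neq0// scale1r subrK//.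
  by rewrite -scalemxAl scalerA divff ?lt0r_neq0// scale1r -mulmxDl subrK.
have r0' : 0 < ((2 ^- k)^-1 : R) by rewrite invr_gt0.
rewrite -lee_pdivlMl ?exprn_gt0// -[((2 ^- k) ^+ n)^-1]exprVn.
apply: le_trans (lebesgue_outer_affine (- (2 ^- k)^-1 *: v *m T) _ r0').
apply: le_lebesgue_outer => _ [x Qx <-].
exists ((2 ^- k *: x + v) *m T); first by exists (2 ^- k *: x + v) => //; exact/E.
rewrite mulmxDl scalerDr -scalemxAl scalerA mulVf ?lt0r_neq0// scale1r.
by rewrite -scalemxAl scaleNr -addrA subrr addr0.
Qed.

Lemma unit_ball_lebesgue_fin : (mu (@unit_ball R n) < +oo)%E.
Proof.
apply: le_lt_trans (_ : (_ <= (box_volume (Some (const_mx (- 1), const_mx 1)))%:E)%E) _.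
  apply: le_trans (lebesgue_outer_box _); apply: le_lebesgue_outer => x x1 j.
  have := le_lt_trans (coord_le_enorm x j) x1; rewrite !mxE ltr_norml.
  by move=> /andP[-> /ltW].
exact: ltry.
Qed.

(* All dyadic cubes are dilated by the same factor C under T. Writing the ball,
   which T preserves, as a disjoint union of dyadic cubes shows that C = 1. *)
Lemma lebesgue_outer_orthogonal T A : T *m T^T = 1%:M ->
  (mu (mulmx^~ T @` A) <= mu A)%E.
Proof.
move=> TT; case: (@lebesgue_outer_trivial_or_box R n) => [mu0|mu1].
  by rewrite !mu0.
pose C := mu (mulmx^~ T @` @unit_cube R n).
suff C1 : C = 1%E.
  rewrite -[leRHS]mul1e; apply: lebesgue_outer_image_le => // x _.
  exists 0%N => l _; rewrite dyadic_image_mulmx -/C C1 mule1 mul1r.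
  by rewrite lexx.
pose B : set 'rV[R]_n := @unit_ball R n.
have [x Bx|F [FB BF tF]] :=
    @dyadic_decomposition R n (fun q => dyadic_cube (Some q) `<=` B) B.
  have [k Bk] := open_dyadic (@open_unit_ball R n) Bx.
  by exists k; exact: Bk.
have FB' i : dyadic_cube (F i) `<=` B.
  by case E : (F i) => [q|]//; exact: FB E.
have BE : B = \bigcup_i dyadic_cube (F i).
  by apply/seteqP; split => // x [i _]; exact: FB'.
have TI := hyp_inverse_mulmx TT.
have [i0 _] := BF 0 (unit_ball0 R n); case Fi : (F i0) => [[k z]|]// _.
have kzB : dyadic_cube (Some (k, z)) `<=` B by exact: FB Fi.
have vk : 0 < vol k by rewrite exprn_gt0// invr_gt0 exprn_gt0.
have TBB : mulmx^~ T @` B = B.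
  rewrite (hyp_inverse_image TI)//.
  apply/seteqP; split => [x []//|x x1]; split => //.
  by have [_ [TB _] _ _] := TI; exact: TB.
(* C is finite because the image of a cube contained in the ball stays in the ball. *)
have [c CE] : exists c, c%:E = C.
  suff : (C < +oo)%E.
    have : (0 <= C)%E by exact: lebesgue_outer_ge0.
    by case: C => // c _ _; exists c.
  have : ((vol k)%:E * C <= mu B)%E.
    rewrite -(dyadic_image_mulmx T k z) -[in leRHS]TBB; apply: le_lebesgue_outer.
    exact: image_subset.
  rewrite -lee_pdivlMl// => /le_lt_trans; apply.
  apply: lte_mul_pinfty unit_ball_lebesgue_fin; rewrite ?lee_fin ?invr_ge0 ?ltW//.
have muB0 : (0 < mu B)%E.
  apply: lt_le_trans (le_lebesgue_outer kzB).
  by rewrite lebesgue_outer_dyadic// lte_fin.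
have BTB : B = \bigcup_i (mulmx^~ T @` dyadic_cube (F i)).
  by rewrite -image_bigcup -BE TBB.
(* As 0 < mu B < +oo, this equation forces C = 1. *)
have muB : mu B = (C * mu B)%E.
  rewrite {1}BTB lebesgue_outer_bigcup; last 2 first.
  - move=> i; rewrite (hyp_inverse_image TI)//.
    apply: box_preimage_measurable.
      exact: open_lebesgue_measurable (@open_unit_ball R n).
    by move=> j; apply: hyp_isometry_measurable; case: TI.
  - apply/trivIsetP => i j _ _ ij.
    rewrite (hyp_inverse_image TI)//.
    rewrite (hyp_inverse_image (A := dyadic_cube (F j)) TI)//.
    rewrite setIACA -preimage_setI; have /trivIsetP/(_ i j I I ij)/= -> := tF.
    by rewrite preimage_set0 setI0.
  rewrite [in RHS]BE lebesgue_outer_bigcup//; last first.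
    by move=> i; exact: dyadic_cube_measurable.
  rewrite -CE -nneseriesZl; last by move=> i _; exact: lebesgue_outer_ge0.
  apply: eq_eseriesr => i _; case: (F i) => [[l w]|].
    by rewrite CE dyadic_image_mulmx muleC lebesgue_outer_dyadic.
  by rewrite image_set0 lebesgue_outer0 mule0.
have Bfin : mu B \is a fin_num.
  by rewrite ge0_fin_numE ?unit_ball_lebesgue_fin// lebesgue_outer_ge0.
move: muB muB0 Bfin; rewrite -CE; case: (mu B) => [b| |]//.
rewrite -EFinM lte_fin => -[bE] b0 _; congr EFin.
by apply: (mulIf (lt0r_neq0 b0)); rewrite mul1r -bE.
Qed.

End Images.

(** * Change of variables *)

Section Jacobian.
Context (R : realType) (n : nat).
Implicit Types (A B X U : set 'rV[R]_n) (a b v x y z : 'rV[R]_n) (T : 'M[R]_n).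
Implicit Types g : 'rV[R]_n -> 'rV[R]_n.
Local Notation mu := (@lebesgue_outer R n).

(** The absolute Jacobian determinant of g at x, the differential being a similarity of the ratio
    that is raised to the power n. *)
Definition hyp_jac g x : R := ((1 - dot (g x) (g x)) / (1 - dot x x)) ^+ n.

Lemma hyp_jac_ge0 g x : hyp_isometry g -> unit_ball x -> 0 <= hyp_jac g x.
Proof.
move=> gI x1; have := gI.1 x x1; move: x1; rewrite !unit_ballE => x1 gx1.
by rewrite exprn_ge0// divr_ge0// subr_ge0 ltW.
Qed.

Lemma hyp_density_jac g x : hyp_isometry g -> unit_ball x ->
  hyp_density (g x) * hyp_jac g x = hyp_density x.
Proof.
move=> gI x1; have := gI.1 x x1; move: x1.
rewrite !unit_ballE -!(subr_gt0 _ 1) => /lt0r_neq0 x1 /lt0r_neq0 gx1.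
by rewrite /hyp_density /hyp_jac !sqr_enorm expr_div_n mulrA mulVf ?mul1r// expf_neq0.
Qed.

(** With y = g 0 one has g x = h_y(w) for some w with |w| = |x|. Then the conformal factor is (1 -
    |y|^2) / [h_den y w], and [h_den y w] >= (1 - |y| |w|)^2 >= (1 - |y|)^2. *)
Lemma hyp_jac_bounded g : hyp_isometry g ->
  exists2 M, 0 < M & forall x, unit_ball x -> hyp_jac g x < M.
Proof.
move=> gI; pose y := g 0; have y1 : unit_ball y := gI.1 _ (unit_ball0 R n).
have y1' : enorm y < 1 by [].
have [T TT gT] := hyp_isometry_normal_form gI (unit_ball0 R n).
have Y0 : 0 < 1 - dot y y by rewrite subr_gt0 -unit_ballE.
have d0 : 0 < (1 - enorm y) ^+ 2 by rewrite exprn_gt0// subr_gt0.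
exists (((1 - dot y y) / (1 - enorm y) ^+ 2) ^+ n + 1).
  by rewrite ltr_wpDl// exprn_ge0// divr_ge0// ltW.
move=> x x1; apply: (@le_lt_trans _ _ (((1 - dot y y) / (1 - enorm y) ^+ 2) ^+ n));
  last by rewrite ltrDl.
have gx1 := gI.1 x x1.
have X0 : 0 < 1 - dot x x by rewrite subr_gt0 -unit_ballE.
have GX0 : 0 < 1 - dot (g x) (g x) by rewrite subr_gt0 -unit_ballE.
apply: lerXn2r; rewrite ?nnegrE ?divr_ge0 ?(ltW X0) ?(ltW Y0) ?(ltW d0) ?(ltW GX0)//.
set w := h_map 0 x *m T; have wE : dot w w = dot x x.
  rewrite dot_mulmx_orthogonal// h_mapE /h_den !dot0l.
  by rewrite !(mulr0, mul0r, subr0, addr0) invr1 scaler0 !scale1r sub0r !dotE opprK.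
have w1 : unit_ball w by rewrite unit_ballE wE -unit_ballE.
have den0 := h_den_gt0 y1 w1.
have [+ _] := h_map_dot (lt0r_neq0 den0) (lt0r_neq0 den0).
have -> : h_map y w = g x by rewrite /w -gT// h_map_involutive.
rewrite wE => ->.
rewrite mulrAC mulfK ?lt0r_neq0//; apply: ler_wpM2l; first exact: ltW.
rewrite lef_pV2 ?posrE// /h_den.
have := dot_le_enorm y w; rewrite ler_norml => /andP[_].
have : enorm w < 1 by []; have := enorm_ge0 y; have := enorm_ge0 w.
rewrite -!sqr_enorm; move: (enorm y) (enorm w) y1' => s t s1 t0 s0 t1 st.
have : (1 - s) ^+ 2 <= (1 - s * t) ^+ 2.
  by apply: lerXn2r; rewrite ?nnegrE; nra.
by lra.
Qed.

(** On a cube of side r through x, g is a similarity of ratio s up to an error of order r^2, so the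
    image of the cube lies in the similar image of a cube widened by a multiple of r^2. Its measure
    is at most s^n r^n (1 + 2 L r)^n, hence at most M r^n for small r because s^n < M. *)
Lemma hyp_isometry_outer_le g A (M : R) : hyp_isometry g -> A `<=` unit_ball ->
  (forall x, A x -> hyp_jac g x < M) -> 0 <= M -> (mu (g @` A) <= M%:E * mu A)%E.
Proof.
move=> gI AB AM M0; apply: lebesgue_outer_image_le => // x Ax.
have x1 := AB x Ax; have gx1 := gI.1 x x1.
have [T [K [d [TT K0 d0 gT]]]] := hyp_isometry_first_order gI x1.
have := AM x Ax; rewrite /hyp_jac; set s : R := (_ / _) in gT * => sM.
have s0 : 0 < s by rewrite divr_gt0// subr_gt0 -unit_ballE.
(* The error is at most K (n r)^2 and is divided by s when pulled back through the similarity; the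
   added 1 makes the bound strict, as the open faces of the box require. *)
pose L : R := (K * n%:R ^+ 2 + 1) / s.
have L0 : 0 < L by rewrite divr_gt0// ltr_wpDl// mulr_ge0 ?sqr_ge0// ltW.
have [e e0 eM] : exists2 e, 0 < e &
    forall r, 0 <= r -> r < e -> s ^+ n * (1 + 2 * L * r) ^+ n <= M.
  have cf : {for 0, continuous (fun r : R => s ^+ n * (1 + 2 * L * r) ^+ n)}.
    apply: cvgM; first exact: cvg_cst.
    apply: (@continuous_comp _ _ _ (fun r : R => 1 + 2 * L * r) (fun t : R => t ^+ n));
      last exact: exprn_continuous.
    apply: cvgD; first exact: cvg_cst.
    by apply: cvgM; [exact: cvg_cst|exact: cvg_id].
  have := @cvgr_lt _ _ (nbhs (0 : R)) _ _ _ cf M.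
  rewrite mulr0 addr0 expr1n mulr1 => /(_ (nbhs_filter _) sM).
  move=> /nbhs_ballP[e /= e0 eM]; exists e => // r r0 re; apply/ltW/eM.
  by rewrite /ball/= sub0r normrN ger0_norm.
have [k1 k1B] := open_dyadic (@open_unit_ball R n) x1.
have [k2 k2e] := pow2V_lt e0.
have [|k3 k3d] := @pow2V_lt R (d / n.+1%:R); first by rewrite divr_gt0.
exists (maxn k1 (maxn k2 k3)) => l; rewrite !geq_max => /and3P[l1 l2 l3].
pose r : R := 2 ^- l; have r0 : 0 < r by rewrite invr_gt0 exprn_gt0.
set q := (l, dyadic_cell l x).
pose dl := L * r ^+ 2; have dl0 : 0 < dl by rewrite mulr_gt0// exprn_gt0.
pose a := (dyadic_box R q).1 - const_mx dl.
pose b := (dyadic_box R q).2 + const_mx dl.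
have volE : box_volume (Some (a, b)) = (r * (1 + 2 * L * r)) ^+ n.
  rewrite /= (eq_bigr (fun=> r * (1 + 2 * L * r))) ?prodr_const ?card_ord// => j _.
  rewrite /a /b !mxE intrB mulrBl mul1r -/r /dl.
  rewrite (_ : _ - _ = r * (1 + 2 * L * r)); last by ring.
  apply/max_r; have Lr := mulr_ge0 (ltW L0) (ltW r0).
  by rewrite mulr_ge0 ?(ltW r0)//; lra.
have Qx : dyadic_cube (Some q) x by exact/dyadic_cubeP.
have sub : g @` dyadic_cube (Some q) `<=`
    (fun z => s *: z + (g x - s *: (x *m T))) @` (mulmx^~ T @` box_set (Some (a, b))).
  move=> _ [z Qz <-]; have z1 := k1B l l1 z Qz.
  have zxr : enorm (z - x) <= n%:R * r.
    apply: enorm_le_coord => [|j]; first exact: ltW.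
    by rewrite !mxE; apply/ltW; apply: dyadic_cube_diam Qz Qx.
  have := gT (z - x); rewrite addrC subrK => /(_ z1).
  have -> : enorm (z - x) <= d.
    apply: le_trans zxr _; have := k3d l l3; rewrite -/r ltr_pdivlMr// => /ltW.
    apply: le_trans; rewrite mulrC ler_pM2l// ler_nat//.
  set e' := g z - g x - _ => /(_ isT) e'E.
  (* The error is absorbed into the argument: the similarity sends y exactly to g z. *)
  pose y := z + s^-1 *: (e' *m T^T).
  exists (y *m T).
    exists y => // j; have := Qz j; rewrite /a /b.
    have : `|y 0 j - z 0 j| < dl.
      have -> : y 0 j - z 0 j = (s^-1 *: (e' *m T^T)) 0 j.
        by rewrite mxE addrC addKr.
      apply: le_lt_trans (coord_le_enorm _ _) _.
      rewrite enormZ (enorm_orthogonal _ (orthogonal_trmx TT)) gtr0_norm ?invr_gt0//.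
      rewrite mulrC ltr_pdivrMr// /dl /L mulrAC divfK ?lt0r_neq0//.
      apply: le_lt_trans e'E _.
      rewrite mulrDl mul1r -mulrA -exprMn ltr_pwDr ?exprn_gt0//.
      by rewrite ler_pM2l// ler_pXn2r ?nnegrE ?enorm_ge0// mulr_ge0// ltW.
    rewrite ltr_norml !mxE; lra.
  rewrite /y mulmxDl -scalemxAl -mulmxA (mulmx1C TT) mulmx1 scalerDr scalerA.
  rewrite divff ?lt0r_neq0// scale1r /e' mulmxBl scalerBr.
  by apply/rowP => j; rewrite !mxE; ring.
apply: le_trans (le_lebesgue_outer sub) _.
apply: le_trans (lebesgue_outer_affine _ _ s0) _.
apply: le_trans (lee_wpmul2l _ (lebesgue_outer_orthogonal _ TT)) _.
  by rewrite lee_fin exprn_ge0// ltW.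
apply: le_trans (lee_wpmul2l _ (lebesgue_outer_box _)) _.
  by rewrite lee_fin exprn_ge0// ltW.
rewrite -EFinM lee_fin volE [(r * _) ^+ n]exprMn mulrCA -/r [leLHS]mulrC.
apply: ler_wpM2r; first by rewrite exprn_ge0// ltW.
by apply: eM; [exact: ltW|exact: k2e].
Qed.

End Jacobian.

(* The weight w is 1 when I is the measure of an image, and the Jacobian when I
   is the integral of a function over an image. *)
Lemma le_integral_level_sets d (T : measurableType d) (R : realType)
    (mu : {measure set T -> \bar R}) (I : set T -> \bar R) (A : set T)
    (f w : T -> R) :
  measurable A -> measurable_fun A f -> measurable_fun A w ->
  (forall x, A x -> 0 <= f x) -> (forall x, A x -> 0 <= w x) ->
  (\int[mu]_(x in A) (w x)%:E < +oo)%E ->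
  (forall E, (0 <= I E)%E) ->
  (forall E : nat -> set T, (forall k, measurable (E k)) ->
    (forall k, E k `<=` A) -> trivIset setT E ->
    (I (\bigcup_k E k) <= \sum_(k <oo) I (E k))%E) ->
  (forall E M, measurable E -> E `<=` A -> 0 <= M ->
    (forall x, E x -> f x < M) -> (I E <= M%:E * \int[mu]_(x in E) (w x)%:E)%E) ->
  (I A <= \int[mu]_(x in A) (f x * w x)%:E)%E.
Proof.
move=> mA mf mw f0 w0 wfin I0 Isub Ibound.
have mfw B (c : R) : measurable B -> B `<=` A ->
    measurable_fun B (EFin \o (fun x => (f x + c) * w x : R)).
  move=> mB BA; apply/measurable_EFinP/measurable_funM.
    by apply: measurable_funD => //; exact: measurable_funS mf.
  exact: measurable_funS mw.
have mw' B : measurable B -> B `<=` A -> measurable_fun B (EFin \o w).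
  by move=> mB BA; apply/measurable_EFinP; exact: measurable_funS mw.
suff H (e : R) : 0 < e -> (I A <= \int[mu]_(x in A) (f x * w x)%:E +
    e%:E * \int[mu]_(x in A) (w x)%:E)%E.
  have : (0 <= \int[mu]_(x in A) (w x)%:E)%E.
    by apply: integral_ge0 => x Ax; rewrite lee_fin w0.
  case E : (\int[mu]_(x in A) (w x)%:E)%E wfin H => [r| |]// _ H r0.
  apply/lee_addgt0Pr => e e0; apply: le_trans (H (e / (r + 1)) _) _.
    by rewrite divr_gt0// ltr_wpDl.
  rewrite leeD2l// -EFinM lee_fin mulrAC ler_pdivrMr ?ltr_wpDl// ler_pM2l//.
  by rewrite lerDl.
(* On the slice [E k] the bound (k + 1) e exceeds f by at most e, which accounts for the extra term
   e times the integral of w. *)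
move=> e0; pose E k := A `&` f @^-1` `[k%:R * e, k.+1%:R * e[.
have mE k : measurable (E k) by apply: mf => //; exact: measurable_itv.
have EA k : E k `<=` A by move=> x [].
have inE x k : E k x <-> A x /\ Num.truncn (f x / e) = k.
  split=> -[Ax fx]; split => //.
    apply/truncn_def; move: fx; rewrite /= in_itv/=.
    by rewrite ler_pdivlMr// ltr_pdivrMr.
  rewrite /= in_itv/= -ler_pdivlMr// -ltr_pdivrMr// -fx; apply: truncn_itv.
  by rewrite divr_ge0 ?f0// ltW.
have tE : trivIset setT E.
  by move=> i j _ _ [x [/inE[_ <-] /inE[_ <-]]].
have AE : A = \bigcup_k E k.
  apply/seteqP; split => [x Ax|x [k _ /inE[]//]].
  by exists (Num.truncn (f x / e)) => //; apply/inE.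
rewrite -ge0_integralZl//; [|exact: mw'|by rewrite lee_fin ltW].
rewrite -ge0_integralD//; last 4 first.
- by move=> x Ax; rewrite lee_fin mulr_ge0 ?f0 ?w0.
- apply: (eq_measurable_fun (EFin \o (fun x => (f x + 0) * w x : R))); last exact: mfw.
  by move=> x _; rewrite /= addr0.
- by move=> x Ax; rewrite -EFinM lee_fin mulr_ge0 ?w0// ltW.
- by apply: measurable_funeM; exact: mw'.
rewrite (eq_integral (fun x => ((f x + e) * w x)%:E)); last first.
  by move=> x _; rewrite -EFinM -EFinD mulrDl.
rewrite [in X in integral mu X _]AE ge0_integral_bigcup -?AE//; last 2 first.
- exact: mfw.
- by move=> x Ax; rewrite lee_fin mulr_ge0 ?addr_ge0 ?f0 ?w0// ltW.
have := Isub E mE EA tE; rewrite -AE => /le_trans; apply.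
have Ik k : (I (E k) <= \int[mu]_(x in E k) ((f x + e) * w x)%:E)%E.
  apply: le_trans (Ibound (E k) (k.+1%:R * e) _ _ _ _) _ => //.
  - by rewrite mulr_ge0// ltW.
  - by move=> x [_ /=]; rewrite in_itv/= => /andP[].
  rewrite -ge0_integralZl//; last 3 first.
  - exact: mw'.
  - by move=> x /EA Ax; rewrite lee_fin w0.
  - by rewrite lee_fin mulr_ge0// ltW.
  apply: ge0_le_integral => //.
  - by move=> x /EA Ax; rewrite -EFinM lee_fin !mulr_ge0 ?w0// ltW.
  - by apply: measurable_funeM; exact: mw'.
  - exact: mfw.
  move=> x [Ax /=]; rewrite in_itv/= => /andP[fx _].
  by rewrite -EFinM lee_fin ler_wpM2r ?w0// -natr1 mulrDl mul1r lerD2r.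
by apply: lee_nneseries.
Qed.

(** * Measurability of images and integrals over them *)

Section ChangeOfVariables.
Context (R : realType) (n : nat).
Implicit Types (A B X U : set 'rV[R]_n) (a b v x y z : 'rV[R]_n) (T : 'M[R]_n).
Implicit Types g : 'rV[R]_n -> 'rV[R]_n.
Local Notation mu := (@lebesgue_outer R n).
Local Notation leb := (@lebesgue_measureRn R n).
Local Notation LR := (lebesgueRn R n).
Local Notation ball := (@unit_ball R n).

Lemma null_lebesgue_measurable A : mu A = 0%E -> lebesgue_measurable A.
Proof.
move=> A0; apply: le_caratheodory_measurable => X.
rewrite [X in (X + _)%E](_ : _ = 0%E) ?add0e; first exact: le_lebesgue_outer.
apply/eqP; rewrite eq_le lebesgue_outer_ge0 andbT -A0.
exact: le_lebesgue_outer.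
Qed.

Lemma unit_ball_measurable : lebesgue_measurable ball.
Proof. exact/open_lebesgue_measurable/open_unit_ball. Qed.

(** U is a countable union of dyadic cubes, whose images are preimages of boxes under the
    coordinatewise measurable map [g']. *)
Lemma hyp_inverse_open_image g g' U : hyp_inverse g g' -> open U ->
  U `<=` ball -> lebesgue_measurable (g @` U).
Proof.
move=> gg' oU UB; have [gI g'I _ _] := gg'.
have [x Ux|F [FU UF _]] :=
    @dyadic_decomposition R n (fun q => dyadic_cube (Some q) `<=` U) U.
  by have [k kU] := open_dyadic oU Ux; exists k; exact: kU.
rewrite (hyp_inverse_image gg')// (_ : U = \bigcup_i dyadic_cube (F i)).
  rewrite preimage_bigcup setI_bigcupr; apply: bigcup_measurable => i _.
  apply: box_preimage_measurable; first exact: unit_ball_measurable.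
  by move=> j; exact: hyp_isometry_measurable.
apply/seteqP; split => // x [i _].
by case E : (F i) => [q|]//; exact: FU E _.
Qed.

(** A is approximated from outside by open sets U_k with mu(U_k \ A) <= 1 / (k + 1). Since g
    enlarges measures by a bounded factor, the image of A differs from the measurable intersection
    of the images of the U_k by a null set. *)
Lemma hyp_inverse_measurable g g' A : hyp_inverse g g' -> A `<=` ball ->
  lebesgue_measurable A -> lebesgue_measurable (g @` A).
Proof.
move=> gg' AB mA; have [gI g'I gK g'K] := gg'.
have [M M0 gM] := hyp_jac_bounded gI.
have Afin : mu A \is a fin_num.
  rewrite ge0_fin_numE ?lebesgue_outer_ge0//.
  exact: le_lt_trans (le_lebesgue_outer AB) (unit_ball_lebesgue_fin _ _).
have /choice[U PU] : forall k, exists U, [/\ open U, A `<=` U, U `<=` ball &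
    (mu (U `\` A) <= (k.+1%:R^-1)%:E)%E].
  move=> k; have [|U oU [AU Uk]] := @lebesgue_outer_regular R n A k.+1%:R^-1.
    by rewrite invr_gt0.
  have oUB : open (U `&` ball) by apply: openI => //; exact: open_unit_ball.
  exists (U `&` ball); split => //.
  - by move=> x Ax; split; [exact: AU|exact: AB].
  have mUB := open_lebesgue_measurable oUB.
  have := @measureD _ LR R leb _ _ mUB mA.
  rewrite (_ : _ `&` A = A); last first.
    by apply/seteqP; split => [x []//|x Ax]; split => //; split; [exact: AU|exact: AB].
  rewrite /= /lebesgue_measureRn => -> //; last first.
    apply: le_lt_trans (unit_ball_lebesgue_fin R n).
    by apply: le_lebesgue_outer => x [].
  rewrite leeBlDl//; apply: le_trans Uk; apply: le_lebesgue_outer.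
  by move=> x [].
pose G := \bigcap_k (g @` U k).
have mG : lebesgue_measurable G.
  apply: bigcapT_measurable => k; have [oU _ UB _] := PU k.
  exact: (hyp_inverse_open_image gg' oU UB).
have AG : g @` A `<=` G.
  by move=> _ [x Ax <-] k _; exists x => //; have [_ AU _ _] := PU k; exact: AU.
have N0 : mu (G `\` g @` A) = 0%E.
  apply/eqP; rewrite eq_le lebesgue_outer_ge0 andbT.
  apply/lee_addgt0Pr => e e0; rewrite add0e.
  have [k Mk] : exists k, M / k.+1%:R < e.
    exists (Num.truncn (M / e)).
    by rewrite ltr_pdivrMr// mulrC -ltr_pdivrMr// truncnS_gt.
  have [oU AU UB Uk] := PU k.
  apply: (@le_trans _ _ (mu (g @` (U k `\` A)))).
    apply: le_lebesgue_outer => y [Gy nAy]; have [x Ux xy] := Gy k I.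
    by exists x => //; split => // Ax; apply: nAy; exists x.
  apply: le_trans (hyp_isometry_outer_le (M := M) gI _ _ (ltW M0)) _.
  - by move=> x [/UB].
  - by move=> x [/UB x1 _]; exact: gM.
  apply: le_trans (lee_wpmul2l _ Uk) _; first by rewrite lee_fin ltW.
  by rewrite -EFinM lee_fin ltW.
rewrite (_ : g @` A = G `\` (G `\` g @` A)); last by rewrite setDD setIidr.
by apply: measurableD => //; exact: null_lebesgue_measurable.
Qed.

Lemma hyp_jac_measurable g : hyp_isometry g ->
  measurable_fun (ball : set LR) (hyp_jac g : LR -> R).
Proof.
move=> gI; apply: (eq_measurable_fun
  (fun x : LR => (1 - \sum_(j < n) g x 0 j * g x 0 j) ^+ n * hyp_density x : R)).
  by move=> x _; rewrite /hyp_jac expr_div_n /hyp_density sqr_enorm.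
apply: measurable_funM.
  apply: measurable_funX; apply: measurable_funB => //.
  apply: measurable_sum => j.
  by apply: measurable_funM; exact: hyp_isometry_measurable.
apply: continuous_lebesgue_measurable; first exact: open_unit_ball.
exact: hyp_density_continuous.
Qed.

Lemma lebesgue_outer_le_integral_jac g g' A : hyp_inverse g g' -> A `<=` ball ->
  lebesgue_measurable A ->
  (mu (g @` A) <= \int[leb]_(x in (A : set LR)) (hyp_jac g x)%:E)%E.
Proof.
move=> gg' AB mA; have [gI g'I gK g'K] := gg'.
rewrite (eq_integral (fun x : LR => (hyp_jac g x * cst 1 x)%:E)); last first.
  by move=> x _; rewrite /= mulr1.
have int1 (E : set LR) : measurable E ->
    (\int[leb]_(x in E) (cst 1 x)%:E = mu E)%E.
  by move=> mE; have := integral_cst leb mE 1%E; rewrite mul1e.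
apply: (@le_integral_level_sets _ LR R leb (fun E => mu (g @` E))) => //.
- apply: measurable_funS (hyp_jac_measurable gI) => //.
  exact: unit_ball_measurable.
- by move=> x /AB; exact: hyp_jac_ge0.
- rewrite int1//.
  exact: le_lt_trans (le_lebesgue_outer AB) (unit_ball_lebesgue_fin _ _).
- by move=> E; exact: lebesgue_outer_ge0.
- move=> E _ _ _; rewrite image_bigcup.
  exact: lebesgue_outer_sigma_subadditive.
- move=> E M mE EA M0 EM; rewrite int1//.
  by apply: hyp_isometry_outer_le => // x /EA/AB.
Qed.

(** Continuity of g only controls preimages of Borel sets; a Lebesgue-measurable preimage under f is
    instead transported as an image under [g']. *)
Lemma hyp_inverse_comp_measurable g g' (f : 'rV[R]_n -> R) : hyp_inverse g g' ->
  measurable_fun (ball : set LR) (f : LR -> R) ->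
  measurable_fun (ball : set LR) ((f \o g) : LR -> R).
Proof.
move=> gg' mf _ Y mY; have [gI g'I gK g'K] := gg'.
have -> : ball `&` (f \o g) @^-1` Y = g' @` (ball `&` f @^-1` Y).
  rewrite (hyp_inverse_image (hyp_inverse_sym gg')); last by move=> x [].
  apply/seteqP; split => [x [x1 fx]|x [x1 []]//].
  by split => //; split => //; exact: gI.1.
apply: hyp_inverse_measurable (hyp_inverse_sym gg') _ _ => [x []//|].
by apply: mf => //; exact: unit_ball_measurable.
Qed.

Lemma integral_image_le g g' A (f : 'rV[R]_n -> R) : hyp_inverse g g' ->
  A `<=` ball -> lebesgue_measurable A ->
  measurable_fun (ball : set LR) (f : LR -> R) ->
  (forall x, ball x -> 0 <= f x) ->
  (\int[leb]_(x in (g @` A : set LR)) (f x)%:E <=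
   \int[leb]_(x in (A : set LR)) (f (g x) * hyp_jac g x)%:E)%E.
Proof.
move=> gg' AB mA mf f0; have [gI g'I gK g'K] := gg'.
have mB := unit_ball_measurable.
have gB E : E `<=` ball -> g @` E `<=` ball.
  by move=> EB _ [x /EB x1 <-]; exact: gI.1.
(* The absolute value makes [I] nonnegative on all sets, including those that leave the ball. *)
pose I (E : set LR) : \bar R := (\int[leb]_(x in (g @` E : set LR)) `|(f x)%:E|)%E.
have IE E : E `<=` ball -> I E = (\int[leb]_(x in (g @` E : set LR)) (f x)%:E)%E.
  move=> EB; apply: eq_integral => x; rewrite inE => /(gB _ EB) x1.
  by rewrite gee0_abs// lee_fin f0.
rewrite -IE//; apply: (@le_integral_level_sets _ LR R leb I A (f \o g) (hyp_jac g)) => //.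
- by apply: measurable_funS (hyp_inverse_comp_measurable gg' mf).
- by apply: measurable_funS (hyp_jac_measurable gI).
- by move=> x /AB x1; apply: f0; exact: gI.1.
- by move=> x /AB; exact: hyp_jac_ge0.
- have [M M0 gM] := hyp_jac_bounded gI.
  apply: (@le_lt_trans _ _ (\int[leb]_(x in (A : set LR)) (cst M%:E x))%E).
    apply: ge0_le_integral => //.
    + by move=> x /AB x1; rewrite lee_fin hyp_jac_ge0.
    + by apply/measurable_EFinP; apply: measurable_funS (hyp_jac_measurable gI).
    + by move=> x /AB x1; rewrite lee_fin ltW// gM.
  rewrite integral_cst// lte_mul_pinfty// ?lee_fin ?ltW//.
  exact: le_lt_trans (le_lebesgue_outer AB) (unit_ball_lebesgue_fin _ _).
- by move=> E; apply: integral_ge0.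
- move=> E mE EA tE; have EB k := subset_trans (EA k) AB.
  rewrite {1}/I image_bigcup ge0_integral_bigcup//.
    by move=> k; exact: (hyp_inverse_measurable gg' (EB k) (mE k)).
    apply: (measurableT_comp (@abse_measurable R _)).
    apply/measurable_EFinP; apply: measurable_funS mf => // x [k _].
    exact: gB.
  apply/trivIsetP => i j _ _ ij; rewrite -subset0.
  move=> _ [[x Ex <-] [y Ey]] yx.
  have xy : y = x by rewrite -(gK y (EB j y Ey)) yx (gK x (EB i x Ex)).
  have /trivIsetP/(_ i j Logic.I Logic.I ij) /seteqP[+ _] := tE.
  by move=> /(_ x); apply; split => //; rewrite -xy.
- move=> E M mE EA M0 EM; have EB := subset_trans EA AB.
  rewrite IE//.
  apply: (@le_trans _ _ (\int[leb]_(x in (g @` E : set LR)) (cst M%:E x))%E).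
    apply: ge0_le_integral => //.
    + exact: (hyp_inverse_measurable gg' EB mE).
    + by move=> x /(gB _ EB) x1; rewrite lee_fin f0.
    + apply/measurable_EFinP; apply: measurable_funS mf => //; exact: gB.
    + by move=> _ [x Ex <-]; rewrite lee_fin ltW// EM.
  rewrite integral_cst//; last exact: (hyp_inverse_measurable gg' EB mE).
  rewrite lee_wpmul2l//.
  exact: lebesgue_outer_le_integral_jac gg' EB mE.
Qed.

End ChangeOfVariables.

(** * Conformal barycenters *)

Section HyperbolicIntegral.
Context (R : realType) (n : nat).
Implicit Types (A D : set 'rV[R]_n) (a c x y z : 'rV[R]_n) (T : 'M[R]_n).
Implicit Types g : 'rV[R]_n -> 'rV[R]_n.
Local Notation leb := (@lebesgue_measureRn R n).
Local Notation LR := (lebesgueRn R n).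
Local Notation ball := (@unit_ball R n).

Lemma hyp_density_ge0 x : ball x -> 0 <= hyp_density x.
Proof.
rewrite unit_ballE => x1.
by rewrite /hyp_density sqr_enorm invr_ge0 exprn_ge0// subr_ge0 ltW.
Qed.

Lemma hyp_density_measurable : measurable_fun (ball : set LR)
  (@hyp_density R n : LR -> R).
Proof.
apply: continuous_lebesgue_measurable; first exact: open_unit_ball.
exact: hyp_density_continuous.
Qed.

Lemma hyp_integral_image_le g g' A (f : 'rV[R]_n -> R) : hyp_inverse g g' ->
  A `<=` ball -> lebesgue_measurable A ->
  measurable_fun (ball : set LR) (f : LR -> R) ->
  (forall x, ball x -> 0 <= f x) ->
  (hyp_integral (g @` A) f <= hyp_integral A (f \o g))%E.
Proof.
move=> gg' AB mA mf f0; have [gI _ _ _] := gg'.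
have mfd : measurable_fun (ball : set LR) ((fun x => f x * hyp_density x) : LR -> R).
  by apply: measurable_funM => //; exact: hyp_density_measurable.
apply: le_trans (integral_image_le gg' AB mA mfd _) _.
  by move=> x x1; rewrite mulr_ge0 ?f0 ?hyp_density_ge0.
rewrite le_eqVlt; apply/orP; left; apply/eqP; apply: eq_integral => x.
by rewrite inE => /AB x1; rewrite /= -mulrA hyp_density_jac.
Qed.

Lemma hyp_inverse_imageK g g' A : hyp_inverse g g' -> A `<=` ball ->
  g' @` (g @` A) = A.
Proof.
move=> [_ _ gK _] AB; apply/seteqP; split => [_ [_ [x Ax <-] <-]|x Ax].
  by rewrite gK//; exact: AB.
by exists (g x); [exists x|rewrite gK//; exact: AB].
Qed.

Lemma hyp_inverse_sub_ball g g' A : hyp_inverse g g' -> A `<=` ball ->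
  g @` A `<=` ball.
Proof. by move=> [gI _ _ _] AB _ [x /AB x1 <-]; exact: gI.1. Qed.

Lemma hyp_integral_image_ge0 g g' A (f : 'rV[R]_n -> R) : hyp_inverse g g' ->
  A `<=` ball -> lebesgue_measurable A ->
  measurable_fun (ball : set LR) (f : LR -> R) ->
  (forall x, ball x -> 0 <= f x) ->
  hyp_integral (g @` A) f = hyp_integral A (f \o g).
Proof.
move=> gg' AB mA mf f0; have [gI g'I _ g'K] := gg'.
have gAB := hyp_inverse_sub_ball gg' AB.
apply/eqP; rewrite eq_le (hyp_integral_image_le gg')//=.
rewrite -[X in (hyp_integral X _ <= _)%E](hyp_inverse_imageK gg' AB).
apply: le_trans (hyp_integral_image_le (hyp_inverse_sym gg') gAB _ _ _) _.
- exact: (hyp_inverse_measurable gg').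
- exact: (hyp_inverse_comp_measurable gg').
- by move=> x x1; apply: f0; exact: gI.1.
rewrite le_eqVlt; apply/orP; left; apply/eqP; apply: eq_integral => x.
by rewrite inE => /gAB x1; rewrite /= g'K.
Qed.

(** The integral is the difference of those of the positive and negative parts, and multiplication
    by a nonnegative density commutes with taking these parts. *)
Lemma hyp_integral_posneg A (f : 'rV[R]_n -> R) : A `<=` ball ->
  hyp_integral A f = (hyp_integral A (fun x => Num.max (f x) 0)%R -
                      hyp_integral A (fun x => Num.max (- f x) 0)%R)%E.
Proof.
move=> AB; rewrite /hyp_integral integralE; congr (_ - _)%E; apply: eq_integral => x.
  rewrite inE => /AB x1; rewrite funeposE -EFin_max; congr EFin.
  by rewrite maxr_pMl ?hyp_density_ge0// mul0r.
rewrite inE => /AB x1; rewrite funenegE -EFinN -EFin_max; congr EFin.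
by rewrite maxr_pMl ?hyp_density_ge0// mul0r mulNr.
Qed.

Lemma hyp_integral_image g g' A (f : 'rV[R]_n -> R) : hyp_inverse g g' ->
  A `<=` ball -> lebesgue_measurable A ->
  measurable_fun (ball : set LR) (f : LR -> R) ->
  hyp_integral (g @` A) f = hyp_integral A (f \o g).
Proof.
move=> gg' AB mA mf; have gAB := hyp_inverse_sub_ball gg' AB.
rewrite (hyp_integral_posneg _ gAB) (hyp_integral_posneg _ AB); congr (_ - _)%E.
  apply: (hyp_integral_image_ge0 gg' AB mA (f := fun x => Num.max (f x) 0)).
    exact: (@measurable_maxr _ LR R ball f (cst 0) mf (measurable_cst _)).
  by move=> x _; rewrite le_max lexx orbT.
apply: (hyp_integral_image_ge0 gg' AB mA (f := fun x => Num.max (- f x) 0)).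
  exact: (@measurable_maxr _ LR R ball (\- f) (cst 0) (measurable_funN mf)
    (measurable_cst _)).
by move=> x _; rewrite le_max lexx orbT.
Qed.

Lemma hyp_measure_image g g' A : hyp_inverse g g' -> A `<=` ball ->
  lebesgue_measurable A -> hyp_measure (g @` A) = hyp_measure A.
Proof.
move=> gg' AB mA; have E D : hyp_measure D = hyp_integral D (fun=> 1).
  by apply: eq_integral => x _; rewrite mul1r.
by rewrite !E (hyp_integral_image gg' AB mA (measurable_cst _)).
Qed.

Lemma barycenter_domain_image g g' A : hyp_inverse g g' ->
  barycenter_domain A -> barycenter_domain (g @` A).
Proof.
move=> gg' [AB mA LA]; split.
- exact: (hyp_inverse_sub_ball gg').
- exact: (hyp_inverse_measurable gg').
- by rewrite (hyp_measure_image gg').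
Qed.

(** The coordinates of h_y are bounded by 1 on the ball, so the density dominates, and its integral
    over A is finite. This integrability allows the integral to be exchanged with the linear map
    T. *)
Lemma hyp_integrable_h_map A y j : barycenter_domain A -> ball y ->
  leb.-integrable (A : set LR) (fun x : LR => (h_map y x 0 j * hyp_density x)%:E).
Proof.
move=> [AB mA /andP[_ Afin]] y1; have mB := @unit_ball_measurable R n.
have md := measurable_funS mB AB hyp_density_measurable.
apply: (@le_integrable _ LR R leb _ mA _ (EFin \o (@hyp_density R n))).
- apply/measurable_EFinP; apply: (measurable_funM _ md).
  apply: (measurable_funS mB AB).
  exact: hyp_isometry_measurable (hyp_isometry_h_map y1).
- move=> x /AB x1; rewrite /= lee_fin normrM ler_piMl//.
  apply: le_trans (coord_le_enorm _ _) _; apply: ltW.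
  exact: h_map_unit_ball.
apply/integrableP; split; first exact/measurable_EFinP.
apply: le_lt_trans Afin; rewrite le_eqVlt; apply/orP; left; apply/eqP.
apply: eq_integral => x; rewrite inE => /AB x1 /=.
by rewrite ger0_norm// hyp_density_ge0.
Qed.

Lemma hyp_integral_h_map_image g g' A y : hyp_inverse g g' ->
  barycenter_domain A -> ball y ->
  (forall i, hyp_integral A (fun x => h_map y x 0 i) = 0%E) ->
  forall i, hyp_integral (g @` A) (fun x => h_map (g y) x 0 i) = 0%E.
Proof.
move=> gg' dA y1 Ay0 i; have [AB mA _] := dA; have [gI _ _ _] := gg'.
have gy1 := gI.1 y y1; have [T _ gT] := hyp_isometry_normal_form gI y1.
rewrite (hyp_integral_image gg' AB mA); last first.
  exact: hyp_isometry_measurable (hyp_isometry_h_map gy1).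
(* Coordinate i of h_(g y)(g x) is a combination of the coordinates of h_y(x), with column i of T as
   coefficients. *)
transitivity (\int[leb]_(x in (A : set LR))
    (\sum_(j < n) (T j i)%:E * (h_map y x 0 j * hyp_density x)%:E))%E.
  apply: eq_integral => x; rewrite inE => /AB x1 /=.
  rewrite gT// mxE mulr_suml -sumEFin; apply: eq_bigr => j _.
  by rewrite -EFinM mulrAC mulrC.
rewrite (@integral_sum _ LR R leb _ mA); last first.
  by move=> j; apply: integrableZl => //; exact: hyp_integrable_h_map.
apply: big1 => j _; rewrite integralZl//; last exact: hyp_integrable_h_map.
by have := Ay0 j; rewrite /hyp_integral => ->; rewrite mule0.
Qed.

Lemma is_conformal_barycenter_image g g' A c : hyp_inverse g g' ->
  is_conformal_barycenter A c -> is_conformal_barycenter (g @` A) (g c).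
Proof.
move=> gg' [dA [[c1 Ac] cuniq]]; have [gI g'I _ g'K] := gg'.
have dgA := barycenter_domain_image gg' dA; have [AB _ _] := dA.
split; first exact: dgA.
split => [|y [y1 Ay]].
  split; first exact: gI.1.
  exact: (hyp_integral_h_map_image gg' dA c1 Ac).
(* A second solution y for the image is pulled back by [g'] to a solution for A, which must be c. *)
suff -> : c = g' y by exact: g'K.
apply: cuniq; split; first exact: g'I.1.
rewrite -(hyp_inverse_imageK gg' AB).
exact: (hyp_integral_h_map_image (hyp_inverse_sym gg') dgA y1 Ay).
Qed.

(** As h is prescribed on the ball only, it is replaced by the globally defined formula T o h_a,
    whose inverse on the ball is h_a o T^-1 because h_a is an involution. *)
Lemma is_mobius_hyp_inverse h : is_mobius h ->
  exists g g', hyp_inverse g g' /\ forall x, ball x -> h x = g x.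
Proof.
move=> [T [a [TT a1 hT]]].
have aI := hyp_isometry_h_map a1; have [TI T'I TK T'K] := hyp_inverse_mulmx TT.
exists (mulmx^~ T \o h_map a), (h_map a \o mulmx^~ T^T); split => //.
split; [exact: hyp_isometry_comp|exact: hyp_isometry_comp| |] => x x1 /=.
  by rewrite TK ?h_map_involutive//; exact: aI.1.
by rewrite h_map_involutive ?T'K//; exact: T'I.1.
Qed.

End HyperbolicIntegral.

Theorem theorem4p6 (R : realType) (n : nat) (D : set 'rV[R]_n)
    (c : 'rV[R]_n) (h : 'rV[R]_n -> 'rV[R]_n)
    (hD : D `<=` unit_ball) (mD : lebesgue_measurable D)
    (LD : (0 < hyp_measure D < +oo)%E)
    (hc : is_conformal_barycenter D c) (hh : is_mobius h) :
  is_conformal_barycenter (h @` D) (h c).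
Proof.
have [g [g' [gg' hg]]] := is_mobius_hyp_inverse hh.
have [_ [[c1 _] _]] := hc; rewrite hg//.
rewrite (eq_imagel (f' := g)); last by move=> x /hD; exact: hg.
exact: is_conformal_barycenter_image gg' hc.
Qed.
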